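(* Let $\Gamma$ be a finite graph. (1) $C(\Gamma)\in\mathcal{S}$ if and only if for every collection $\mathcal{G}=\{G_v : v\in V(\Gamma)\}$ of nontrivial groups, $GP(\Gamma,\mathcal{G})\in\mathcal{S}$. (2) $A(\Gamma)\in\mathcal{S}$ if and only if there exists a collection $\mathcal{G}=\{G_v : v\in V(\Gamma)\}$ of cyclic groups such that $GP(\Gamma,\mathcal{G})\in\mathcal{S}$. (3) The following are equivalent: (a) $[A(\Gamma),A(\Gamma)]\in\mathcal{S}$; (b) there exists a collection $\mathcal{G}=\{G_v : v\in V(\Gamma)\}$ of finite groups such that $GP(\Gamma,\mathcal{G})\in\mathcal{S}$; (c) $GP_m(\Gamma)\in\mathcal{S}$ for some $2\le m<\infty$.
   Context: A graph means a simplicial 1-complex (no loops, no multiple edges). The graph product $GP(\Gamma,\mathcal{G})$ is the quotient of the free product of the groups $G_v$ by the normal closure of $\{[g,h] : g\in G_u, h\in G_v, \{u,v\}\in E(\Gamma)\}$. For $2\le m\le\infty$, $GP_m(\Gamma)$ denotes the graph product over $\Gamma$ in which every vertex group is cyclic of order $m$ (infinite cyclic if $m=\infty$). $A(\Gamma)=GP_\infty(\Gamma)$ is the right-angled Artin group and $C(\Gamma)=GP_2(\Gamma)$ is the right-angled Coxeter group on $\Gamma$. $\mathcal{S}$ is the class of groups that contain a hyperbolic surface group, i.e. a subgroup isomorphic to the fundamental group of a closed hyperbolic surface. *)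

(* Defs.v *)
From HB Require Import structures.
From mathcomp Require Import all_boot all_order all_algebra.
From mathcomp Require Import generic_quotient.
From mathcomp Require Import all_classical all_reals all_analysis.
From mathcomp Require Import lra.

Set Implicit Arguments.
Unset Strict Implicit.
Unset Printing Implicit Defensive.

Import Order.TTheory GRing.Theory Num.Theory.
Import numFieldNormedType.Exports.

Local Open Scope classical_set_scope.

Section Pregroup.
Local Open Scope quotient_scope.

Record pregroup (T : choiceType) := Pregroup {
  pg_eq : T -> T -> Prop;
  pg_one : T;
  pg_inv : T -> T;
  pg_mul : T -> T -> T;
  pg_refl : forall x, pg_eq x x;
  pg_sym : forall x y, pg_eq x y -> pg_eq y x;
  pg_trans : forall x y z, pg_eq x y -> pg_eq y z -> pg_eq x z;
  pg_congrV : forall x y, pg_eq x y -> pg_eq (pg_inv x) (pg_inv y);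
  pg_congrM : forall x x' y y', pg_eq x x' -> pg_eq y y' ->
    pg_eq (pg_mul x y) (pg_mul x' y');
  pg_mulA : forall x y z,
    pg_eq (pg_mul x (pg_mul y z)) (pg_mul (pg_mul x y) z);
  pg_mul1 : forall x, pg_eq (pg_mul pg_one x) x;
  pg_mulx1 : forall x, pg_eq (pg_mul x pg_one) x;
  pg_mulV : forall x, pg_eq (pg_mul (pg_inv x) x) pg_one;
  pg_mulxV : forall x, pg_eq (pg_mul x (pg_inv x)) pg_one
}.

Variables (T : choiceType) (P : pregroup T).

Definition pg_rel : rel T := fun x y => `[< pg_eq P x y >].

Fact pg_rel_refl : reflexive pg_rel.
Proof. by move=> x; apply/asboolP; exact: pg_refl. Qed.

Fact pg_rel_sym : symmetric pg_rel.
Proof. by move=> x y; apply/asboolP/asboolP; exact: pg_sym. Qed.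

Fact pg_rel_trans : transitive pg_rel.
Proof. by move=> y x z /asboolP xy /asboolP yz; apply/asboolP; exact: pg_trans yz. Qed.

Canonical pg_equiv := EquivRel pg_rel pg_rel_refl pg_rel_sym pg_rel_trans.

Definition pg_quot := {eq_quot pg_equiv}.

HB.instance Definition _ := Choice.on pg_quot.

Definition pg_class (x : T) : pg_quot := \pi_{eq_quot pg_equiv} x.

Definition pg_repr (a : pg_quot) : T := repr a.

Lemma pg_classP x y : pg_class x = pg_class y <-> pg_eq P x y.
Proof.
split=> [/eqP|xy]; first by rewrite eqmodE => /asboolP.
by apply/eqP; rewrite eqmodE; exact/asboolP.
Qed.

Lemma pg_reprK a : pg_class (pg_repr a) = a.
Proof. exact: reprK. Qed.

Lemma pg_classK x : pg_eq P (pg_repr (pg_class x)) x.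
Proof. by apply/pg_classP; rewrite pg_reprK. Qed.

Definition pg_qmul (a b : pg_quot) := pg_class (pg_mul P (pg_repr a) (pg_repr b)).
Definition pg_qinv (a : pg_quot) := pg_class (pg_inv P (pg_repr a)).

Fact pg_qmulE x y : pg_qmul (pg_class x) (pg_class y) = pg_class (pg_mul P x y).
Proof. by apply/pg_classP; apply: pg_congrM; exact: pg_classK. Qed.

Fact pg_qinvE x : pg_qinv (pg_class x) = pg_class (pg_inv P x).
Proof. by apply/pg_classP; apply: pg_congrV; exact: pg_classK. Qed.

Fact pg_qmulA : associative pg_qmul.
Proof.
move=> a b c; rewrite -(pg_reprK a) -(pg_reprK b) -(pg_reprK c) !pg_qmulE.
by apply/pg_classP; exact: pg_mulA.
Qed.

Fact pg_qmul1 : left_id (pg_class (pg_one P)) pg_qmul.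
Proof.
by move=> a; rewrite -(pg_reprK a) pg_qmulE; apply/pg_classP; exact: pg_mul1.
Qed.

Fact pg_qmulx1 : right_id (pg_class (pg_one P)) pg_qmul.
Proof.
by move=> a; rewrite -(pg_reprK a) pg_qmulE; apply/pg_classP; exact: pg_mulx1.
Qed.

Fact pg_qmulV : left_inverse (pg_class (pg_one P)) pg_qinv pg_qmul.
Proof.
move=> a; rewrite -(pg_reprK a) pg_qinvE pg_qmulE.
by apply/pg_classP; exact: pg_mulV.
Qed.

Fact pg_qmulxV : right_inverse (pg_class (pg_one P)) pg_qinv pg_qmul.
Proof.
move=> a; rewrite -(pg_reprK a) pg_qinvE pg_qmulE.
by apply/pg_classP; exact: pg_mulxV.
Qed.

HB.instance Definition _ := isGroup.Build pg_quot
  pg_qmulA pg_qmul1 pg_qmulx1 pg_qmulV pg_qmulxV.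

Lemma pg_classM x y : pg_class (pg_mul P x y) = (pg_class x * pg_class y)%g.
Proof. by rewrite [RHS]pg_qmulE. Qed.

Lemma pg_classV x : pg_class (pg_inv P x) = (pg_class x)^-1%g.
Proof. by rewrite [RHS]pg_qinvE. Qed.

Lemma pg_class1 : pg_class (pg_one P) = 1%g.
Proof. by []. Qed.

End Pregroup.

Section Subgroups.
Local Open Scope group_scope.
Variable G : groupType.
Implicit Types (A H N : set G).

Definition is_subgroup H :=
  [/\ H 1, forall x y, H x -> H y -> H (x * y) & forall x, H x -> H x^-1].

Definition is_normal N := is_subgroup N /\ forall x g, N x -> N (x ^ g).

Definition generated A : set G := smallest is_subgroup A.

Definition normal_closure A : set G := smallest is_normal A.

Definition commutators : set G := [set z | exists x y : G, z = [~ x, y]].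

Lemma is_subgroup_generated A : is_subgroup (generated A).
Proof.
split=> [H [[]] //|x y Hx Hy H HA|x Hx H HA].
  by case: (HA) => -[_ HM _] _; apply: HM; [exact: Hx|exact: Hy].
by case: (HA) => -[_ _ HV] _; apply: HV; exact: Hx.
Qed.

Lemma is_normal_normal_closure A : is_normal (normal_closure A).
Proof.
split; first split=> [H [[[]]] //|x y Hx Hy H HA|x Hx H HA].
- by case: (HA) => -[[_ HM _] _] _; apply: HM; [exact: Hx|exact: Hy].
- by case: (HA) => -[[_ _ HV] _] _; apply: HV; exact: Hx.
by move=> x g Hx H HA; case: (HA) => -[_ HJ] _; apply: HJ; exact: Hx.
Qed.

Definition cyclic_group := exists g : G, generated [set g] = setT.

Definition finite_group := finite_set [set: G].

Definition nontrivial_group := exists g : G, g <> 1.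

Definition derived_subgroup := set_type (generated commutators).

HB.instance Definition _ := SubChoice.on derived_subgroup.

Fact derived_subgroup_closed : group_closed (mem (generated commutators)).
Proof.
have [H1 HM HV] := is_subgroup_generated commutators.
split; first by rewrite inE.
by move=> x y /[!inE] Hx Hy; apply: HM => //; exact: HV.
Qed.

HB.instance Definition _ := SubChoice_isSubGroup.Build G
  (mem (generated commutators)) derived_subgroup derived_subgroup_closed.

End Subgroups.

Section QuotientGroup.
Local Open Scope group_scope.
Variables (G : groupType) (N : set G) (nN : is_normal N).

Let coset_eq (x y : G) := N (x^-1 * y).

Fact coset_eq_refl x : coset_eq x x.
Proof. by case: nN => -[N1 _ _] _; rewrite /coset_eq mulVg. Qed.

Fact coset_eq_sym x y : coset_eq x y -> coset_eq y x.
Proof. by case: nN => -[_ _ NV] _ /NV; rewrite /coset_eq invgM invgK. Qed.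

Fact coset_eq_trans x y z : coset_eq x y -> coset_eq y z -> coset_eq x z.
Proof.
case: nN => -[_ NM _] _ Nxy /(NM _ _ Nxy).
by rewrite /coset_eq mulgA mulgK.
Qed.

Fact coset_eqV x y : coset_eq x y -> coset_eq x^-1 y^-1.
Proof.
case: nN => -[_ _ NV] NJ /NV /(NJ _ x^-1).
by rewrite /coset_eq invgM invgK /conjg invgK !mulgA mulgK.
Qed.

Fact coset_eqM x x' y y' :
  coset_eq x x' -> coset_eq y y' -> coset_eq (x * y) (x' * y').
Proof.
case: nN => -[_ NM _] NJ Nx Ny; have := NM _ _ (NJ _ y Nx) Ny.
by rewrite /coset_eq /conjg invgM !mulgA mulgK.
Qed.

Fact coset_eq_eq x y : x = y -> coset_eq x y.
Proof. by move=> ->; exact: coset_eq_refl. Qed.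

Definition quotient_pregroup : pregroup G :=
  @Pregroup _ coset_eq 1 (fun x => x^-1) *%g
    coset_eq_refl coset_eq_sym coset_eq_trans coset_eqV coset_eqM
    (fun x y z => coset_eq_eq (mulgA x y z)) (fun x => coset_eq_eq (mul1g x))
    (fun x => coset_eq_eq (mulg1 x)) (fun x => coset_eq_eq (mulVg x))
    (fun x => coset_eq_eq (mulgV x)).

Definition quotient_group : groupType := pg_quot quotient_pregroup.

End QuotientGroup.

Section FreeProduct.
Local Open Scope group_scope.
Variables (I : choiceType) (G : I -> groupType).

Definition letter := {i : I & G i}.

Inductive word_eq : seq letter -> seq letter -> Prop :=
| word_eq_refl w : word_eq w w
| word_eq_sym w1 w2 : word_eq w1 w2 -> word_eq w2 w1
| word_eq_trans w1 w2 w3 : word_eq w1 w2 -> word_eq w2 w3 -> word_eq w1 w3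
| word_eq_cat w1 w1' w2 w2' :
    word_eq w1 w1' -> word_eq w2 w2' -> word_eq (w1 ++ w2) (w1' ++ w2')
| word_eq_one i : word_eq [:: Tagged G (1 : G i)] [::]
| word_eq_mul i (x y : G i) :
    word_eq [:: Tagged G x; Tagged G y] [:: Tagged G (x * y)].

Definition letter_inv (l : letter) : letter := Tagged G (tagged l)^-1.

Definition word_inv (w : seq letter) := rev (map letter_inv w).

Fact word_eq_inv w1 w2 : word_eq w1 w2 -> word_eq (word_inv w1) (word_inv w2).
Proof.
elim=> {w1 w2} [w|w1 w2 _ h|w1 w2 w3 _ h _ h'|w1 w1' w2 w2' _ h _ h'|i|i x y].
- exact: word_eq_refl.
- exact: word_eq_sym.
- exact: word_eq_trans h'.
- by rewrite /word_inv !map_cat !rev_cat; exact: word_eq_cat.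
- by rewrite /word_inv /= /letter_inv /= invg1; exact: word_eq_one.
- by rewrite /word_inv /= /letter_inv /= invgM; exact: word_eq_mul.
Qed.

Fact word_inv_mul w : word_eq (word_inv w ++ w) [::].
Proof.
elim: w => [|[i x] w IH]; first exact: word_eq_refl.
rewrite /word_inv map_cons rev_cons -cats1 -catA.
apply: word_eq_trans IH; apply: word_eq_cat; first exact: word_eq_refl.
rewrite (_ : _ ++ _ = [:: letter_inv (Tagged G x); Tagged G x] ++ w) //.
apply: (@word_eq_trans _ ([::] ++ w)); last exact: word_eq_refl.
apply: word_eq_cat; last exact: word_eq_refl.
apply: word_eq_trans (word_eq_mul _ _) _.
by rewrite /= mulVg; exact: word_eq_one.
Qed.

Fact word_invK : involutive word_inv.
Proof.
move=> w; rewrite /word_inv -map_rev revK -map_comp map_id_in // => -[i x] _ /=.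
by rewrite /letter_inv /= invgK.
Qed.

Fact word_mul_inv w : word_eq (w ++ word_inv w) [::].
Proof. by rewrite -{1}[w]word_invK; exact: word_inv_mul. Qed.

Fact word_eq_eq w1 w2 : w1 = w2 -> word_eq w1 w2.
Proof. by move=> ->; exact: word_eq_refl. Qed.

Definition free_product_pregroup : pregroup (seq letter) :=
  @Pregroup _ word_eq [::] word_inv cat word_eq_refl word_eq_sym word_eq_trans word_eq_inv word_eq_cat
    (fun x y z => word_eq_eq (catA x y z)) word_eq_refl
    (fun x => word_eq_eq (cats0 x)) word_inv_mul word_mul_inv.

Definition free_product : groupType := pg_quot free_product_pregroup.

Definition free_product_in (i : I) (x : G i) : free_product :=
  pg_class free_product_pregroup [:: Tagged G x].

End FreeProduct.

Section GraphProduct.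
Local Open Scope group_scope.
Variables (V : finType) (E : rel V).

Definition graph_relators (G : V -> groupType) : set (free_product G) :=
  [set z | exists (u v : V) (g : G u) (h : G v),
    E u v /\ z = [~ free_product_in g, free_product_in h]].

Definition graph_product (G : V -> groupType) : groupType :=
  quotient_group (is_normal_normal_closure (@graph_relators G)).

(** Only meaningful for [1 < m]: ['Z_m] is [Z/mZ] exactly in that case. *)
Definition GPm (m : nat) : groupType :=
  graph_product (fun _ => Algebra.to_multiplicative 'Z_m).

Definition raag : groupType :=
  graph_product (fun _ => Algebra.to_multiplicative int).

Definition racg : groupType := GPm 2.

End GraphProduct.

Section ContinuityLemmas.
Local Open Scope ring_scope.
Variable R : realType.

Definition clamp (t : R) : R := Num.max 0 (Num.min 1 t).

Lemma clamp_itv t : `[0, 1]%classic (clamp t).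
Proof.
rewrite /= in_itv /= /clamp le_max lexx /= ge_max ler01 /=.
by rewrite ge_min lexx.
Qed.

Lemma clamp_id t : `[0, 1]%classic t -> clamp t = t.
Proof.
by rewrite /= in_itv /= => /andP[t0 t1]; rewrite /clamp min_r // max_r.
Qed.

Lemma continuous_minf (X : topologicalType) (f g : X -> R) :
  continuous f -> continuous g -> continuous (fun x => Num.min (f x) (g x)).
Proof. by move=> cf cg x; apply: continuous_min; [exact: cf|exact: cg]. Qed.

Lemma continuous_maxf (X : topologicalType) (f g : X -> R) :
  continuous f -> continuous g -> continuous (fun x => Num.max (f x) (g x)).
Proof. by move=> cf cg x; apply: continuous_max; [exact: cf|exact: cg]. Qed.

Lemma continuous_cstf (X Y : topologicalType) (y : Y) :
  continuous (fun _ : X => y).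
Proof. by move=> x; exact: cvg_cst. Qed.

Lemma continuous_addf (X : topologicalType) (f g : X -> R) :
  continuous f -> continuous g -> continuous (fun x => f x + g x).
Proof. by move=> cf cg x; apply: cvgD; [exact: cf|exact: cg]. Qed.

Lemma continuous_mulf (X : topologicalType) (f g : X -> R) :
  continuous f -> continuous g -> continuous (fun x => f x * g x).
Proof. by move=> cf cg x; apply: cvgM; [exact: cf|exact: cg]. Qed.

Lemma continuous_oppf (X : topologicalType) (f : X -> R) :
  continuous f -> continuous (fun x => - f x).
Proof. by move=> cf x; apply: cvgN; exact: cf. Qed.

Lemma continuous_pairf (X Y Z : topologicalType) (f : X -> Y) (g : X -> Z) :
  continuous f -> continuous g -> continuous (fun x => (f x, g x)).
Proof. by move=> cf cg x; apply: cvg_pair; [exact: cf|exact: cg]. Qed.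

Lemma continuous_compf (X Y Z : topologicalType) (f : X -> Y) (g : Y -> Z) :
  continuous f -> continuous g -> continuous (fun x => g (f x)).
Proof. by move=> cf cg x; apply: continuous_comp; [exact: cf|exact: cg]. Qed.

Lemma continuous_clamp : continuous clamp.
Proof.
apply: continuous_maxf; first exact: continuous_cstf.
by apply: continuous_minf => [|x]; [exact: continuous_cstf|exact: cvg_id].
Qed.

Lemma continuous_within_comp (X Y Z : topologicalType) (A : set Y)
    (f : Y -> Z) (c : X -> Y) :
  {within A, continuous f} -> continuous c -> (forall x, A (c x)) ->
  continuous (fun x => f (c x)).
Proof.
move=> /subspace_continuousP cf cc Ac x.
move=> W /(cf _ (Ac x)) nW; have := cc x _ nW.
by rewrite /= /nbhs /=; apply: filterS => y /(_ (Ac y)).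
Qed.

Lemma continuous_within_eq (X Y : topologicalType) (A : set X) (f g : X -> Y) :
  continuous g -> (forall x, A x -> f x = g x) -> {within A, continuous f}.
Proof.
move=> cg fg; apply: (@subspace_eq_continuous _ A _ g).
  by move=> x /[!inE] Ax; exact/esym/fg.
exact: continuous_subspaceT.
Qed.

Lemma continuous_paste (X Y : topologicalType) (u : X -> R) (c : R)
    (f g : X -> Y) :
  continuous u -> continuous f -> continuous g ->
  (forall x, u x = c -> f x = g x) ->
  continuous (fun x => if u x <= c then f x else g x).
Proof.
move=> cu cf cg fg.
suff: {within setT, continuous (fun x => if u x <= c then f x else g x)}.
  move=> /subspace_continuousP h x W /(h x I) nW.
  by apply: (@filterS _ (nbhs x) _ _ _ _ nW) => y /(_ I).
rewrite (_ : setT = [set x | u x <= c] `|` [set x | c <= u x]); last first.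
  by apply/seteqP; split=> // x _ /=; apply/orP; exact: le_total.
have /continuous_closedP clu := cu.
apply: withinU_continuous.
- exact: (clu _ (@closed_le R c)).
- exact: (clu _ (@closed_ge R c)).
- by apply: (continuous_within_eq cf) => x /= ->.
- apply: (continuous_within_eq cg) => x /= cx; case: ifP => // xc.
  by apply: fg; apply/eqP; rewrite eq_le cx xc.
Qed.

End ContinuityLemmas.

Section FundamentalGroup.
Local Open Scope ring_scope.
Variables (R : realType) (T : topologicalType) (x0 : T).
Implicit Types p q r : R -> T.

Definition is_loop p :=
  [/\ {within `[0, 1], continuous p}, p 0 = x0 & p 1 = x0].

Definition homotopic p q := exists H : R * R -> T,
  [/\ {within `[0, 1] `*` `[0, 1], continuous H},
      forall s : R, `[0, 1]%classic s -> H (s, 0) = p s /\ H (s, 1) = q s &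
      forall t : R, `[0, 1]%classic t -> H (0, t) = x0 /\ H (1, t) = x0].

Definition concat p q : R -> T :=
  fun s => if s <= 2^-1 then p (2 * s) else q (2 * s - 1).

Definition reverse p : R -> T := fun s => p (1 - s).

(** Loops are functions on all of [R]; the values outside [[0, 1]] are junk,
    which [homotopic] ignores. *)
Record loop := Loop { loop_fun :> R -> T; loopP : is_loop loop_fun }.

HB.instance Definition _ := gen_eqMixin loop.
HB.instance Definition _ := gen_choiceMixin loop.

Local Notation I01 := `[0, 1]%classic.

Fact I0 : I01 (0 : R). Proof. by rewrite /= in_itv /= lexx ler01. Qed.
Fact I1 : I01 (1 : R). Proof. by rewrite /= in_itv /= lexx ler01. Qed.

Fact clamp0 : clamp 0 = 0 :> R. Proof. exact: clamp_id I0. Qed.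
Fact clamp1 : clamp 1 = 1 :> R. Proof. exact: clamp_id I1. Qed.

Fact I01P (t : R) : I01 t <-> 0 <= t /\ t <= 1.
Proof. by rewrite /= in_itv /=; split=> [/andP|h]; last exact/andP. Qed.

Fact loop_continuous p (X : topologicalType) (u : X -> R) :
  is_loop p -> continuous u -> continuous (fun x => p (clamp (u x))).
Proof.
case=> cp _ _ cu; apply: (continuous_within_comp cp) => [|x].
  by apply: continuous_compf cu _; exact: continuous_clamp.
exact: clamp_itv.
Qed.

Fact square_continuous (H : R * R -> T) (X : topologicalType) (u v : X -> R) :
  {within I01 `*` I01, continuous H} -> continuous u -> continuous v ->
  continuous (fun x => H (clamp (u x), clamp (v x))).
Proof.
move=> cH cu cv; apply: (continuous_within_comp cH) => [|x].
  apply: continuous_pairf.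
  - by apply: continuous_compf cu _; exact: continuous_clamp.
  - by apply: continuous_compf cv _; exact: continuous_clamp.
by split; exact: clamp_itv.
Qed.

Fact continuous_fst : continuous (@fst R R).
Proof. by move=> x; exact: cvg_fst. Qed.

Fact continuous_snd : continuous (@snd R R).
Proof. by move=> x; exact: cvg_snd. Qed.

Fact continuous_affine (X : topologicalType) (a b : R) (u : X -> R) :
  continuous u -> continuous (fun x => a * u x + b).
Proof.
move=> cu; apply: continuous_addf; last exact: continuous_cstf.
by apply: continuous_mulf; first exact: continuous_cstf.
Qed.

Fact continuous_idf (X : topologicalType) : continuous (fun x : X => x).
Proof. by move=> x; exact: cvg_id. Qed.

Fact is_loop_cst : is_loop (fun _ => x0).
Proof. by split=> //; apply: continuous_subspaceT; exact: continuous_cstf. Qed.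

Fact is_loop_concat p q : is_loop p -> is_loop q -> is_loop (concat p q).
Proof.
move=> lp lq; case: (lp) (lq) => _ p0 p1 [_ q0 q1]; split; last first.
- rewrite /concat ifF; first by rewrite (_ : 2 * 1 - 1 = 1) //; lra.
  by apply/negbTE; rewrite -ltNge; lra.
- by rewrite /concat ifT ?mulr0 // invr_ge0.
apply: (@continuous_within_eq R T I01 _ (fun s =>
  if s <= 2^-1 then p (clamp (2 * s + 0)) else q (clamp (2 * s + - 1)))).
  apply: continuous_paste; first exact: continuous_idf.
  - by apply: loop_continuous => //; apply/continuous_affine/continuous_idf.
  - by apply: loop_continuous => //; apply/continuous_affine/continuous_idf.
  move=> s ->; rewrite (_ : 2 * 2^-1 + 0 = 1 :> R); last by lra.
  rewrite (_ : 2 * 2^-1 + - 1 = 0 :> R); last by lra.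
  by rewrite clamp0 clamp1 p1 q0.
move=> s /I01P[s0 s1]; rewrite /concat addr0; case: leP => hs.
- by rewrite clamp_id //; apply/I01P; split; lra.
- by rewrite clamp_id //; apply/I01P; split; lra.
Qed.

Fact is_loop_reverse p : is_loop p -> is_loop (reverse p).
Proof.
move=> lp; case: (lp) => _ p0 p1; split; last first.
- by rewrite /reverse subrr.
- by rewrite /reverse subr0.
apply: (@continuous_within_eq R T I01 _ (fun s => p (clamp (- 1 * s + 1)))).
  by apply: loop_continuous => //; apply/continuous_affine/continuous_idf.
move=> s /I01P[s0 s1]; rewrite /reverse (_ : - 1 * s + 1 = 1 - s); last by lra.
by rewrite clamp_id //; apply/I01P; split; lra.
Qed.

Fact homotopic_reparam p (phi psi f g : R -> R) (u v : R -> T) :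
  is_loop p -> continuous phi -> continuous psi ->
  (forall s, I01 s -> I01 (phi s)) -> (forall s, I01 s -> I01 (psi s)) ->
  phi 0 = psi 0 -> phi 1 = psi 1 -> p (phi 0) = x0 -> p (phi 1) = x0 ->
  (forall s, I01 s -> u s = p (phi s)) ->
  (forall s, I01 s -> v s = p (psi s)) ->
  homotopic u v.
Proof.
move=> lp cphi cpsi Iphi Ipsi e0 e1 p0 p1 uE vE.
exists (fun z => p (clamp ((1 - z.2) * phi z.1 + z.2 * psi z.1))); split.
- apply: continuous_subspaceT; apply: loop_continuous => //.
  have c1 : continuous (fun z : R * R => phi z.1).
    by apply: continuous_compf cphi; exact: continuous_fst.
  have c2 : continuous (fun z : R * R => psi z.1).
    by apply: continuous_compf cpsi; exact: continuous_fst.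
  apply: continuous_addf; apply: continuous_mulf => //; last exact: continuous_snd.
  apply: continuous_addf; first exact: continuous_cstf.
  by apply: continuous_oppf; exact: continuous_snd.
- move=> s Is; rewrite /= subr0 mul1r mul0r addr0 subrr mul0r mul1r add0r.
  by rewrite !clamp_id ?uE ?vE //; [exact: Ipsi|exact: Iphi].
move=> t _; rewrite /= -e0 -e1 -!mulrDl !subrK !mul1r !clamp_id //.
- by apply: Iphi; exact: I1.
- by apply: Iphi; exact: I0.
Qed.

Fact homotopic_refl p : is_loop p -> homotopic p p.
Proof.
move=> lp; case: (lp) => _ p0 p1.
exists (fun z => p (clamp z.1)); split.
- by apply: continuous_subspaceT; apply: loop_continuous => //; exact: continuous_fst.
- by move=> s Is /=; rewrite clamp_id.
by move=> t _ /=; rewrite clamp0 clamp1.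
Qed.

Fact homotopic_sym p q : homotopic p q -> homotopic q p.
Proof.
case=> H [cH Hs Ht]; exists (fun z => H (clamp z.1, clamp (- 1 * z.2 + 1))); split.
- apply: continuous_subspaceT; apply: square_continuous => //.
    exact: continuous_fst.
  by apply: continuous_affine; exact: continuous_snd.
- move=> s Is /=; have [h0 h1] := Hs _ Is.
  by rewrite mulr0 add0r mulr1 addNr clamp0 clamp1 clamp_id.
move=> t /I01P[t0 t1] /=.
have It : I01 (- 1 * t + 1) by apply/I01P; split; lra.
by rewrite clamp0 clamp1 clamp_id //; exact: Ht.
Qed.

Fact homotopic_trans p q r : homotopic p q -> homotopic q r -> homotopic p r.
Proof.
case=> H [cH Hs Ht] [K [cK Ks Kt]].
exists (fun z => if z.2 <= 2^-1 then H (clamp z.1, clamp (2 * z.2 + 0))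
                 else K (clamp z.1, clamp (2 * z.2 + - 1))); split.
- apply: continuous_subspaceT; apply: continuous_paste.
  + exact: continuous_snd.
  + apply: square_continuous => //; first exact: continuous_fst.
    by apply: continuous_affine; exact: continuous_snd.
  + apply: square_continuous => //; first exact: continuous_fst.
    by apply: continuous_affine; exact: continuous_snd.
  move=> [s t] /= ->; rewrite (_ : 2 * 2^-1 + 0 = 1 :> R); last by lra.
  rewrite (_ : 2 * 2^-1 + - 1 = 0 :> R); last by lra.
  rewrite clamp0 clamp1.
  by rewrite (Hs _ (clamp_itv s)).2 (Ks _ (clamp_itv s)).1.
- move=> s Is /=; have [h0 h1] := Hs _ Is; have [k0 k1] := Ks _ Is.
  rewrite ifT ?invr_ge0 // ifF; last by apply/negbTE; rewrite -ltNge; lra.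
  rewrite mulr0 addr0 (_ : 2 * 1 + - 1 = 1 :> R); last by lra.
  by rewrite clamp0 clamp1 clamp_id.
move=> t It /=; rewrite clamp0 clamp1.
case: ifP => _; first exact: Ht (clamp_itv _).
exact: Kt (clamp_itv _).
Qed.

Fact homotopic_concat p p' q q' :
  homotopic p p' -> homotopic q q' -> homotopic (concat p q) (concat p' q').
Proof.
case=> H [cH Hs Ht] [K [cK Ks Kt]].
exists (fun z => if z.1 <= 2^-1 then H (clamp (2 * z.1 + 0), clamp z.2)
                 else K (clamp (2 * z.1 + - 1), clamp z.2)); split.
- apply: continuous_subspaceT; apply: continuous_paste.
  + exact: continuous_fst.
  + apply: square_continuous => //; last exact: continuous_snd.
    by apply: continuous_affine; exact: continuous_fst.
  + apply: square_continuous => //; last exact: continuous_snd.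
    by apply: continuous_affine; exact: continuous_fst.
  move=> [s t] /= ->; rewrite (_ : 2 * 2^-1 + 0 = 1 :> R); last by lra.
  rewrite (_ : 2 * 2^-1 + - 1 = 0 :> R); last by lra.
  rewrite clamp0 clamp1.
  by rewrite (Ht _ (clamp_itv t)).2 (Kt _ (clamp_itv t)).1.
- move=> s /I01P[s0 s1] /=.
  rewrite clamp0 clamp1.
  rewrite /concat addr0; case: leP => hs.
  + have I2 : I01 (2 * s) by apply/I01P; split; lra.
    by rewrite clamp_id //; exact: Hs.
  + have I2 : I01 (2 * s - 1) by apply/I01P; split; lra.
    by rewrite clamp_id //; exact: Ks.
move=> t It /=; rewrite ifT ?invr_ge0 // ifF; last first.
  by apply/negbTE; rewrite -ltNge; lra.
rewrite mulr0 addr0 (_ : 2 * 1 + - 1 = 1 :> R); last by lra.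
rewrite clamp0 clamp1 clamp_id //.
by split; [exact: (Ht _ It).1|exact: (Kt _ It).2].
Qed.

Fact homotopic_reverse p q : homotopic p q -> homotopic (reverse p) (reverse q).
Proof.
case=> H [cH Hs Ht]; exists (fun z => H (clamp (- 1 * z.1 + 1), clamp z.2)); split.
- apply: continuous_subspaceT; apply: square_continuous => //.
    by apply: continuous_affine; exact: continuous_fst.
  exact: continuous_snd.
- move=> s /I01P[s0 s1] /=.
  have Is : I01 (1 - s) by apply/I01P; split; lra.
  rewrite (_ : - 1 * s + 1 = 1 - s); last by lra.
  by rewrite clamp0 clamp1 !clamp_id //; exact: Hs.
move=> t It /=; rewrite mulr0 add0r mulr1 addNr.
by rewrite clamp0 clamp1 clamp_id //; case: (Ht _ It).
Qed.

Definition loop_one := Loop is_loop_cst.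
Definition loop_inv (p : loop) := Loop (is_loop_reverse (loopP p)).
Definition loop_mul (p q : loop) := Loop (is_loop_concat (loopP p) (loopP q)).

Definition loop_eq (p q : loop) := homotopic p q.

Fact continuous_affine1 (a b : R) : continuous (fun s : R => a * s + b).
Proof. by apply: continuous_affine; exact: continuous_idf. Qed.

Fact min2P (a b : R) : let m := Num.min a b in
  [/\ m <= a, m <= b & m = a \/ m = b].
Proof. by move=> /=; case: (leP a b) => h; split; try lra; by [left|right]. Qed.

Fact max2P (a b : R) : let m := Num.max a b in
  [/\ a <= m, b <= m & m = a \/ m = b].
Proof. by move=> /=; case: (leP a b) => h; split; try lra; by [left|right]. Qed.

Fact min3P (a b c : R) : let m := Num.min a (Num.min b c) in
  [/\ m <= a, m <= b, m <= c & [\/ m = a, m = b | m = c]].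
Proof.
move=> /=; case: (leP b c) => bc; [case: (leP a b) => h|case: (leP a c) => h];
  split; try lra;
  by [constructor 1|constructor 2|constructor 3].
Qed.

Fact loop_mulA (p q r : loop) :
  loop_eq (loop_mul p (loop_mul q r)) (loop_mul (loop_mul p q) r).
Proof.
pose psi (s : R) :=
  Num.min (2 * s + 0) (Num.min (1 * s + 4^-1) (2^-1 * s + 2^-1)).
have cpsi : continuous psi.
  apply: continuous_minf; first exact: continuous_affine1.
  by apply: continuous_minf; exact: continuous_affine1.
have psiP s : [/\ psi s <= 2 * s + 0, psi s <= 1 * s + 4^-1,
    psi s <= 2^-1 * s + 2^-1 & [\/ psi s = 2 * s + 0,
    psi s = 1 * s + 4^-1 | psi s = 2^-1 * s + 2^-1]] by exact: min3P.
move: psi cpsi psiP => psi cpsi psiP.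
have psi0 : psi 0 = 0 by have [? ? ? []?] := psiP 0; lra.
have psi1 : psi 1 = 1 by have [? ? ? []?] := psiP 1; lra.
have [_ m0 m1] := loopP (loop_mul p (loop_mul q r)).
apply: (@homotopic_reparam (loop_mul p (loop_mul q r)) (fun s => s) psi);
  rewrite ?psi0 ?psi1 //.
- exact: loopP.
- exact: continuous_idf.
- by move=> s /I01P[s0 s1]; apply/I01P; have [? ? ? []?] := psiP s; lra.
move=> s /I01P[s0 s1]; rewrite /= /concat.
have [hle1 hle2 hle3 hor] := psiP s.
case: (leP s 2^-1) => h1; last first.
  have -> : psi s = 2^-1 * s + 2^-1 by case: hor => ?; lra.
  by rewrite !ifF; [congr (r _); lra|apply/negbTE; rewrite -ltNge; lra..].
case: (leP (2 * s) 2^-1) => h2.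
  have -> : psi s = 2 * s by case: hor => ?; lra.
  by rewrite ifT.
have -> : psi s = s + 4^-1 by case: hor => ?; lra.
rewrite ifF; last by apply/negbTE; rewrite -ltNge; lra.
by rewrite ifT; [congr (q _); lra|lra].
Qed.

Fact loop_mul1 (p : loop) : loop_eq (loop_mul loop_one p) p.
Proof.
pose phi (s : R) := Num.max 0 (2 * s + - 1).
have phi0 : phi 0 = 0 by have /= [? ? []?] := max2P 0 (2 * 0 + - 1); rewrite /phi; lra.
have phi1 : phi 1 = 1 by have /= [? ? []?] := max2P 0 (2 * 1 + - 1); rewrite /phi; lra.
have [_ p0 p1] := loopP p.
apply: (@homotopic_reparam p phi (fun s => s)); rewrite ?phi0 ?phi1 //.
- exact: loopP.
- by apply: continuous_maxf; [exact: continuous_cstf|exact: continuous_affine1].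
- exact: continuous_idf.
- by move=> s /I01P[s0 s1]; apply/I01P; have /= [? ? []?] := max2P 0 (2 * s + - 1); rewrite /phi; lra.
move=> s /I01P[s0 s1]; rewrite /= /concat /phi; case: leP => h.
- by rewrite max_l ?p0 //; lra.
- by rewrite max_r //; lra.
Qed.

Fact loop_mulx1 (p : loop) : loop_eq (loop_mul p loop_one) p.
Proof.
pose phi (s : R) := Num.min 1 (2 * s + 0).
have phi0 : phi 0 = 0 by have /= [? ? []?] := min2P 1 (2 * 0 + 0); rewrite /phi; lra.
have phi1 : phi 1 = 1 by have /= [? ? []?] := min2P 1 (2 * 1 + 0); rewrite /phi; lra.
have [_ p0 p1] := loopP p.
apply: (@homotopic_reparam p phi (fun s => s)); rewrite ?phi0 ?phi1 //.
- exact: loopP.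
- by apply: continuous_minf; [exact: continuous_cstf|exact: continuous_affine1].
- exact: continuous_idf.
- by move=> s /I01P[s0 s1]; apply/I01P; have /= [? ? []?] := min2P 1 (2 * s + 0); rewrite /phi; lra.
move=> s /I01P[s0 s1]; rewrite /= /concat /phi addr0; case: leP => h.
- by rewrite min_r //; lra.
- by rewrite min_l ?p1 //; lra.
Qed.

Fact loop_mulV (p : loop) : loop_eq (loop_mul (loop_inv p) p) loop_one.
Proof.
pose phi (s : R) := Num.max (- 2 * s + 1) (2 * s + - 1).
have phi0 : phi 0 = 1 by have /= [? ? []?] := max2P (- 2 * 0 + 1) (2 * 0 + - 1); rewrite /phi; lra.
have phi1 : phi 1 = 1 by have /= [? ? []?] := max2P (- 2 * 1 + 1) (2 * 1 + - 1); rewrite /phi; lra.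
have [_ p0 p1] := loopP p.
apply: (@homotopic_reparam p phi (fun _ => 1)); rewrite ?phi0 ?phi1 //.
- exact: loopP.
- by apply: continuous_maxf; exact: continuous_affine1.
- exact: continuous_cstf.
- by move=> s /I01P[s0 s1]; apply/I01P; have /= [? ? []?] := max2P (- 2 * s + 1) (2 * s + - 1); rewrite /phi; lra.
- by move=> s _; exact: I1.
move=> s /I01P[s0 s1]; rewrite /= /concat /reverse /phi; case: leP => h.
- by rewrite max_l; [congr (p _); lra|lra].
- by rewrite max_r //; lra.
Qed.

Fact loop_mulxV (p : loop) : loop_eq (loop_mul p (loop_inv p)) loop_one.
Proof.
pose phi (s : R) := Num.min (2 * s + 0) (- 2 * s + 2).
have phi0 : phi 0 = 0 by have /= [? ? []?] := min2P (2 * 0 + 0) (- 2 * 0 + 2); rewrite /phi; lra.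
have phi1 : phi 1 = 0 by have /= [? ? []?] := min2P (2 * 1 + 0) (- 2 * 1 + 2); rewrite /phi; lra.
have [_ p0 p1] := loopP p.
apply: (@homotopic_reparam p phi (fun _ => 0)); rewrite ?phi0 ?phi1 //.
- exact: loopP.
- by apply: continuous_minf; exact: continuous_affine1.
- exact: continuous_cstf.
- by move=> s /I01P[s0 s1]; apply/I01P; have /= [? ? []?] := min2P (2 * s + 0) (- 2 * s + 2); rewrite /phi; lra.
- by move=> s _; exact: I0.
move=> s /I01P[s0 s1]; rewrite /= /concat /reverse /phi; case: leP => h.
- by rewrite min_l; [congr (p _); lra|lra].
- by rewrite min_r; [congr (p _); lra|lra].
Qed.

Definition pi1_pregroup : pregroup loop :=
  @Pregroup _ loop_eq loop_one loop_inv loop_mul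
    (fun p : loop => homotopic_refl (loopP p))
    (fun p q : loop => @homotopic_sym p q)
    (fun p q r : loop => @homotopic_trans p q r)
    (fun p q : loop => @homotopic_reverse p q)
    (fun p p' q q' : loop => @homotopic_concat p p' q q')
    loop_mulA loop_mul1 loop_mulx1 loop_mulV loop_mulxV.

Definition pi1 : groupType := pg_quot pi1_pregroup.

End FundamentalGroup.

Section HyperbolicSurface.
Local Open Scope ring_scope.
Variable R : realType.

Definition upper_half_plane : set (R * R) := [set z | 0 < z.2].

Definition arcosh (x : R) : R := ln (x + Num.sqrt (x ^+ 2 - 1)).

(** Upper half-plane model: [cosh d = 1 + |z - w|^2 / (2 Im z Im w)]. *)
Definition hyp_dist (z w : R * R) : R :=
  arcosh (1 + ((z.1 - w.1) ^+ 2 + (z.2 - w.2) ^+ 2) / (2 * z.2 * w.2)).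

Variable S : topologicalType.

(** A chart is a homeomorphism from an open set of [S] onto an open subset of
    the hyperbolic plane; it is stored as a total function on [S], of which
    only the restriction to [chart_dom] matters. *)
Record chart := Chart { chart_dom : set S; chart_map : S -> R * R }.

Definition is_hyp_chart (c : chart) :=
  [/\ open (chart_dom c),
      chart_map c @` chart_dom c `<=` upper_half_plane,
      {within chart_dom c, continuous (chart_map c)},
      set_inj (chart_dom c) (chart_map c) &
      forall U, open U -> U `<=` chart_dom c -> open (chart_map c @` U)].

Definition locally_isometric (c c' : chart) :=
  forall x, chart_dom c x -> chart_dom c' x ->
  exists2 W : set S, nbhs x W &
    W `<=` chart_dom c `&` chart_dom c' /\
    forall y z, W y -> W z ->
      hyp_dist (chart_map c y) (chart_map c z) =
      hyp_dist (chart_map c' y) (chart_map c' z).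

Definition hyperbolic_atlas (A : set chart) :=
  [/\ forall c, A c -> is_hyp_chart c,
      forall x, exists2 c, A c & chart_dom c x &
      forall c c', A c -> A c' -> locally_isometric c c'].

(** The atlas makes [S] a surface without boundary carrying a hyperbolic
    structure; orientability is not required, and second countability follows
    from compactness. *)
Definition closed_hyperbolic_surface :=
  [/\ [set: S] !=set0, connected [set: S], compact [set: S],
      hausdorff_space S & exists A, hyperbolic_atlas A].

End HyperbolicSurface.

Definition contains_surface_group (R : realType) (G : groupType) : Prop :=
  exists (S : topologicalType) (x0 : S) (f : {multiplicative pi1 R x0 -> G}),
    closed_hyperbolic_surface R S /\ injective f.

(* Main.v *)
Require Import Defs.
From HB Require Import structures.
From mathcomp Require Import all_boot all_order all_algebra.
From mathcomp Require Import all_classical all_reals all_analysis.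
From mathcomp Require Import lra zify.

(** The kernel of [graph_product E G -> prod_v G v] depends functorially on the
    vertex groups as mere pointed sets: an element is a word, that is, a path
    in [prod_v G v], and pointwise pointed maps [f v : G v -> G' v] send paths
    to paths.  Hence a pointed injection, which has a pointed retraction,
    induces an embedding of kernels.  The coordinates in which [f v] is a
    morphism need not be killed, and if the group at hand is finitely generated
    then [f v] only has to be injective on a finite set.

    So the surface group has to be moved into a kernel.  When the vertex groups
    concerned are finite this kernel has finite index, and a finite-index
    normal subgroup of a surface group contains the group of a finite covering
    surface, built here as [S * Q] with fibre the quotient group [Q]. *)

Set Implicit Arguments.
Unset Strict Implicit.
Unset Printing Implicit Defensive.

Import Order.TTheory GRing.Theory Num.Theory.
Import numFieldNormedType.Exports.

Local Open Scope classical_set_scope.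

(** * Graph products *)

(** A letter [x] at [v] read from [s] becomes [(f (s v))^-1 * f (s v * x)], so the image of a word
    depends on where its path starts. The induced map is only a cocycle; it is multiplicative on
    elements whose paths return to their starting value in every coordinate where [f v] is not a
    morphism. It respects the defining relations because a letter at [u] does not move the
    coordinate [v]. In (1) the pointed injections go from Z/2 to nontrivial groups. In (2) a finite
    cyclic group is enumerated inside Z, while an infinite one is mapped isomorphically. In (3) the
    kernel for the Artin group is exactly its derived subgroup. The step from Z to Z/m is the
    delicate one: reduction is a morphism but has no retraction on all of Z. Finitely many
    generators give finitely many paths, whose coordinates lie in some interval from -M to M; modulo
    2M + 2 that interval embeds, and a set-theoretic section recovers the generators, hence the
    whole subgroup. The covering needs a monodromy for all paths, not only loops; fixed base paths
    from [x0] supply it. *)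

Section GroupMorphisms.
Local Open Scope group_scope.
Variables (G H : groupType) (f : G -> H).
Hypothesis fM : {morph f : x y / x * y}.

Lemma morph_group1 : f 1 = 1.
Proof. by apply: (mulgI (f 1)); rewrite -fM !mulg1. Qed.

Lemma morph_groupV x : f x^-1 = (f x)^-1.
Proof. by apply: (mulgI (f x)); rewrite -fM !mulgV morph_group1. Qed.

Lemma morph_groupR x y : f [~ x, y] = [~ f x, f y].
Proof. by rewrite /commg /conjg !fM !morph_groupV. Qed.

Lemma is_normal_kernel : is_normal [set x | f x = 1].
Proof.
split; first split=> [|x y /= fx fy|x /= fx].
- exact: morph_group1.
- by rewrite fM fx fy mulg1.
- by rewrite morph_groupV fx invg1.
by move=> x g /= fx; rewrite /conjg !fM morph_groupV fx mul1g mulVg.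
Qed.

Lemma morph_injective : (forall x, f x = 1 -> x = 1) -> injective f.
Proof.
move=> f1 x y fxy; apply/divg1_eq/f1.
by rewrite fM morph_groupV fxy mulgV.
Qed.

End GroupMorphisms.

(** * Universal property of graph products *)

Section Universal.
Local Open Scope group_scope.
Variables (V : finType) (E : rel V) (G : V -> groupType).
Local Notation GP := (graph_product E G).

Definition gp_class : free_product G -> GP := @pg_class _ _.

Lemma gp_classM x y : gp_class (x * y) = gp_class x * gp_class y.
Proof. exact: pg_classM. Qed.

Definition gp_in v (x : G v) : GP := gp_class (free_product_in x).

Lemma free_product_inM v : {morph @free_product_in _ G v : x y / x * y}.
Proof.
move=> x y; rewrite /free_product_in -pg_classM; apply/esym/pg_classP.
exact: word_eq_mul.
Qed.

Lemma gp_inM v : {morph @gp_in v : x y / x * y}.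
Proof. by move=> x y; rewrite /gp_in free_product_inM gp_classM. Qed.

Lemma gp_in1 v : gp_in (1 : G v) = 1.
Proof. exact: morph_group1 (@gp_inM v). Qed.

Lemma gp_in_commute u v (x : G u) (y : G v) :
  E u v -> commute (gp_in x) (gp_in y).
Proof.
move=> uv; apply/commgP/eqP.
rewrite -(morph_groupR gp_classM).
apply: (@etrans _ _ (gp_class 1)); last by [].
apply/pg_classP; rewrite /= mulg1.
have [[_ _ NV] _] := is_normal_normal_closure (@graph_relators V E G).
by apply: (NV) => N [_]; apply; exists u, v, x, y.
Qed.

Lemma gp_ind (P : GP -> Prop) :
  P 1 -> (forall v (x : G v) a, P a -> P (gp_in x * a)) -> forall a, P a.
Proof.
(* A graph product is a quotient of a quotient, so a word is reached through two successive
   representatives. *)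
move=> P1 PM a; rewrite -[a](pg_reprK a) -[pg_repr a](pg_reprK (pg_repr a)).
elim: (pg_repr (pg_repr a)) => [|[v x] w IH]; first exact: P1.
have -> : pg_class (free_product_pregroup G) (existT _ v x :: w) =
    free_product_in x * pg_class _ w :> free_product G.
  by rewrite -pg_classM.
by rewrite -/(gp_class _) gp_classM; exact: PM.
Qed.

Section Lift.
Variables (W : groupType) (h : forall v, G v -> W).
Hypothesis hM : forall v, {morph @h v : x y / x * y}.
Hypothesis hC : forall u v x y, E u v -> commute (@h u x) (@h v y).

Definition word_lift (w : seq (letter G)) : W :=
  foldr (fun l a => h (tagged l) * a) 1 w.

Lemma word_lift_cat w w' : word_lift (w ++ w') = word_lift w * word_lift w'.
Proof. by elim: w => [|l w IH] /=; rewrite ?mul1g // IH mulgA. Qed.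

Lemma word_lift_eq w w' : word_eq w w' -> word_lift w = word_lift w'.
Proof.
elim=> {w w'} [//|//|w1 w2 w3 _ -> _ -> //|w1 w1' w2 w2' _ e _ e'|v|v x y].
- by rewrite !word_lift_cat e e'.
- by rewrite /= mulg1; exact: morph_group1.
- by rewrite /= !mulg1 hM.
Qed.

Definition fp_lift (a : free_product G) : W := word_lift (pg_repr a).

Lemma fp_liftE w : fp_lift (pg_class (free_product_pregroup G) w) = word_lift w.
Proof. exact: word_lift_eq (pg_classK (free_product_pregroup G) w). Qed.

Lemma fp_liftM : {morph fp_lift : x y / x * y}.
Proof.
move=> x y; rewrite -(pg_reprK x) -(pg_reprK y) -pg_classM !fp_liftE.
exact: word_lift_cat.
Qed.

Lemma fp_lift_closure z :
  normal_closure (@graph_relators V E G) z -> fp_lift z = 1.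
Proof.
move=> /(_ [set x | fp_lift x = 1]); apply; split.
  exact: is_normal_kernel fp_liftM.
move=> _ [u [v [x [y [uv ->]]]]] /=.
rewrite (morph_groupR fp_liftM) !fp_liftE /= !mulg1.
by apply/eqP/commgP; exact: hC.
Qed.

Definition gp_lift (a : GP) : W := fp_lift (pg_repr a).

Lemma gp_lift_class z : gp_lift (gp_class z) = fp_lift z.
Proof.
have /fp_lift_closure := pg_classK (quotient_pregroup
  (is_normal_normal_closure (@graph_relators V E G))) z.
rewrite fp_liftM (morph_groupV fp_liftM) => /(canRL (mulVKg _)) ->.
by rewrite mulg1.
Qed.

Lemma gp_liftM : {morph gp_lift : x y / x * y}.
Proof.
move=> x y; rewrite -(pg_reprK x) -(pg_reprK y).
by rewrite -!/(gp_class _) -gp_classM !gp_lift_class fp_liftM.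
Qed.

Lemma gp_lift_in v (x : G v) : gp_lift (gp_in x) = h x.
Proof. by rewrite gp_lift_class fp_liftE /= mulg1. Qed.

End Lift.
End Universal.

(** * Direct products of the vertex groups *)

Section DirectProduct.
Local Open Scope group_scope.
Variables (I : eqType) (G : I -> groupType).

Definition dprodg := forall i, G i.

HB.instance Definition _ := gen_eqMixin dprodg.
HB.instance Definition _ := gen_choiceMixin dprodg.

Implicit Types s t : dprodg.

Let dprodg_one : dprodg := fun=> 1.
Let dprodg_inv s : dprodg := fun i => (s i)^-1.
Let dprodg_mul s t : dprodg := fun i => s i * t i.

Fact dprodg_mulA : associative dprodg_mul.
Proof. by move=> s t u; apply: functional_extensionality_dep => i; exact: mulgA. Qed.

Fact dprodg_mul1g : left_id dprodg_one dprodg_mul.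
Proof. by move=> s; apply: functional_extensionality_dep => i; exact: mul1g. Qed.

Fact dprodg_mulg1 : right_id dprodg_one dprodg_mul.
Proof. by move=> s; apply: functional_extensionality_dep => i; exact: mulg1. Qed.

Fact dprodg_mulVg : left_inverse dprodg_one dprodg_inv dprodg_mul.
Proof. by move=> s; apply: functional_extensionality_dep => i; exact: mulVg. Qed.

Fact dprodg_mulgV : right_inverse dprodg_one dprodg_inv dprodg_mul.
Proof. by move=> s; apply: functional_extensionality_dep => i; exact: mulgV. Qed.

HB.instance Definition _ := isGroup.Build dprodg
  dprodg_mulA dprodg_mul1g dprodg_mulg1 dprodg_mulVg dprodg_mulgV.

Lemma dprodgM s t i : (s * t) i = s i * t i. Proof. by []. Qed.

Lemma dprodg1 i : (1 : dprodg) i = 1. Proof. by []. Qed.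

Definition dprodg_in i (x : G i) : dprodg := dfwith (1 : dprodg) i x.

Lemma dprodg_in_same i (x : G i) : dprodg_in x i = x.
Proof. exact: dfwithin. Qed.

Lemma dprodg_in_diff i j (x : G i) : i != j -> dprodg_in x j = 1.
Proof. exact: dfwithout. Qed.

Lemma dprodg_inM i : {morph @dprodg_in i : x y / x * y}.
Proof.
move=> x y; apply: functional_extensionality_dep => j; rewrite dprodgM.
have [ij|ij] := eqVneq i j; last by rewrite !dprodg_in_diff ?mulg1.
by subst j; rewrite !dprodg_in_same.
Qed.

Lemma dprodg_in_commute i j (x : G i) (y : G j) :
  i != j -> commute (dprodg_in x) (dprodg_in y).
Proof.
move=> ij; apply: functional_extensionality_dep => k; rewrite !dprodgM.
have [ik|ik] := eqVneq i k; last by rewrite dprodg_in_diff // mul1g mulg1.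
by subst k; rewrite (dprodg_in_diff y) ?mul1g ?mulg1 // eq_sym.
Qed.

End DirectProduct.

(** The semidirect product of [G] with the functions [G -> H], for the action
    of [G] on itself by right translation. *)
Section CocycleGroup.
Local Open Scope group_scope.
Variables (G H : groupType).

Definition cocycle := (G * (G -> H))%type.

HB.instance Definition _ := gen_eqMixin cocycle.
HB.instance Definition _ := gen_choiceMixin cocycle.

Implicit Types a b c : cocycle.

Let cocycle_one : cocycle := (1, fun=> 1).
Let cocycle_inv a : cocycle := (a.1^-1, fun s => (a.2 (s * a.1^-1))^-1).
Let cocycle_mul a b : cocycle := (a.1 * b.1, fun s => a.2 s * b.2 (s * a.1)).

Fact cocycle_mulA : associative cocycle_mul.
Proof.
move=> a b c; congr pair; first exact: mulgA.
by apply/funext => s /=; rewrite !mulgA.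
Qed.

Fact cocycle_mul1g : left_id cocycle_one cocycle_mul.
Proof.
move=> [k F]; congr pair; first exact: mul1g.
by apply/funext => s /=; rewrite mulg1 mul1g.
Qed.

Fact cocycle_mulg1 : right_id cocycle_one cocycle_mul.
Proof.
move=> [k F]; congr pair; first exact: mulg1.
by apply/funext => s /=; rewrite mulg1.
Qed.

Fact cocycle_mulVg : left_inverse cocycle_one cocycle_inv cocycle_mul.
Proof.
move=> [k F]; congr pair; first exact: mulVg.
by apply/funext => s /=; rewrite mulVg.
Qed.

Fact cocycle_mulgV : right_inverse cocycle_one cocycle_inv cocycle_mul.
Proof.
move=> [k F]; congr pair; first exact: mulgV.
by apply/funext => s /=; rewrite mulgK mulgV.
Qed.

HB.instance Definition _ := isGroup.Build cocycle
  cocycle_mulA cocycle_mul1g cocycle_mulg1 cocycle_mulVg cocycle_mulgV.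

Lemma cocycleM1 a b : (a * b).1 = a.1 * b.1. Proof. by []. Qed.

Lemma cocycleM2 a b s : (a * b).2 s = a.2 s * b.2 (s * a.1). Proof. by []. Qed.

End CocycleGroup.

(** * Transport of words along pointwise maps *)

Section Shift.
Local Open Scope group_scope.
Variables (V : finType) (E : rel V) (E_irr : irreflexive E).

Lemma edge_neq u v : E u v -> u != v.
Proof. by apply: contraTneq => ->; rewrite E_irr. Qed.

(** Seen on paths, this is the displacement from the starting vertex to the final one. *)
Definition gp_pos (G : V -> groupType) : graph_product E G -> dprodg G :=
  gp_lift (@dprodg_in _ G).

Lemma gp_posM (G : V -> groupType) : {morph @gp_pos G : x y / x * y}.
Proof.
apply: gp_liftM => [v|u v x y uv]; first exact: dprodg_inM.
by apply: dprodg_in_commute; exact: edge_neq.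
Qed.

Lemma gp_pos_in (G : V -> groupType) v (x : G v) :
  gp_pos (gp_in E x) = dprodg_in x.
Proof.
apply: gp_lift_in => [w|u w y z uv]; first exact: dprodg_inM.
by apply: dprodg_in_commute; exact: edge_neq.
Qed.

Section Def.
Variables (G G' : V -> groupType) (f : forall v, G v -> G' v).

(** The edge from [s] to [s * x] in direction [v] is labelled by the quotient of the images of its
    two ends. *)
Let shift_in v (x : G v) : cocycle (dprodg G) (graph_product E G') :=
  (dprodg_in x, fun s => gp_in E ((f (s v))^-1 * f (s v * x))).

Let shift_inM v : {morph @shift_in v : x y / x * y}.
Proof.
move=> x y; congr pair; first exact: dprodg_inM.
apply/funext => s /=; rewrite dprodgM dprodg_in_same -gp_inM.
by rewrite !mulgA mulgK.
Qed.

(** The two letters span a square: as [u] and [v] differ, crossing an edge in one direction does not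
    change the label in the other. *)
Let shift_in_commute u v (x : G u) (y : G v) :
  E u v -> commute (shift_in x) (shift_in y).
Proof.
move=> uv; have ne := edge_neq uv.
have := dprodg_in_commute x y ne; rewrite /commute => e.
congr pair; first exact: e.
apply/funext => s /=; rewrite !dprodgM (dprodg_in_diff x ne) mulg1.
rewrite (dprodg_in_diff y) 1?eq_sym // mulg1.
exact: gp_in_commute.
Qed.

(** The word [x_1 ... x_k] describes a path in the direct product of the
    vertex groups starting at [s]; [gp_shift s] reads off the word of the
    image path under the pointwise map [f]. *)
Definition gp_shift (s : dprodg G) (a : graph_product E G) :
    graph_product E G' := (gp_lift shift_in a).2 s.

Lemma gp_shift_pos a : (gp_lift shift_in a).1 = gp_pos a.
Proof.
elim/gp_ind: a => [|v x a IH].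
  rewrite (morph_group1 (gp_liftM shift_inM shift_in_commute)).
  by rewrite (morph_group1 (@gp_posM G)).
rewrite (gp_liftM shift_inM shift_in_commute) cocycleM1 IH gp_posM gp_pos_in.
by rewrite (gp_lift_in shift_inM shift_in_commute).
Qed.

(** The path of [b] starts where the path of [a] ends. *)
Lemma gp_shiftM s a b : gp_shift s (a * b) = gp_shift s a * gp_shift (s * gp_pos a) b.
Proof.
rewrite /gp_shift (gp_liftM shift_inM shift_in_commute) cocycleM2.
by rewrite gp_shift_pos.
Qed.

Lemma gp_shift1 s : gp_shift s 1 = 1.
Proof.
by rewrite /gp_shift (morph_group1 (gp_liftM shift_inM shift_in_commute)).
Qed.

Lemma gp_shift_in s v (x : G v) :
  gp_shift s (gp_in E x) = gp_in E ((f (s v))^-1 * f (s v * x)).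
Proof. by rewrite /gp_shift (gp_lift_in shift_inM shift_in_commute). Qed.

(** In each coordinate the edge labels telescope. *)
Lemma gp_pos_shift s a v :
  gp_pos (gp_shift s a) v = (f (s v))^-1 * f (s v * gp_pos a v).
Proof.
elim/gp_ind: a s => [|w x a IH] s.
  by rewrite gp_shift1 !(morph_group1 (@gp_posM _)) dprodg1 mulg1 mulVg.
rewrite gp_shiftM !gp_posM !dprodgM IH gp_shift_in !gp_pos_in !dprodgM.
have [wv|wv] := eqVneq w v; last by rewrite !dprodg_in_diff // !mul1g mulg1.
by subst w; rewrite !dprodg_in_same !mulgA mulgK.
Qed.

(** Where [f v] is a morphism the label of an edge is [f v x], wherever the edge starts; in the
    other coordinates the two paths agree at the start, hence throughout. *)
Lemma gp_shift_start s t a :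
  (forall v, {morph @f v : x y / x * y} \/ s v = t v) -> gp_shift s a = gp_shift t a.
Proof.
elim/gp_ind: a s t => [|w x a IH] s t st; first by rewrite !gp_shift1.
rewrite !gp_shiftM !gp_shift_in; congr (gp_in _ _ * _).
  by have [fM|->//] := st w; rewrite !fM !mulKg.
apply: IH => v; have [fM|e] := st v; first by left.
by right; rewrite !dprodgM e.
Qed.

End Def.

Lemma gp_shift_comp (G G' G'' : V -> groupType) (f : forall v, G v -> G' v)
    (r : forall v, G' v -> G'' v) (s : dprodg G) a :
  gp_shift r (fun v => f v (s v)) (gp_shift f s a) =
  gp_shift (fun v x => r v (f v x)) s a.
Proof.
elim/gp_ind: a s => [|w x a IH] s; first by rewrite !gp_shift1.
rewrite !gp_shiftM !gp_shift_in -IH mulVKg; congr (_ * gp_shift _ _ _).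
apply: functional_extensionality_dep => v; rewrite dprodgM gp_pos_in.
rewrite !dprodgM gp_pos_in.
have [wv|wv] := eqVneq w v; last by rewrite !dprodg_in_diff // !mulg1.
by subst w; rewrite !dprodg_in_same mulVKg.
Qed.

(** A word visits finitely many vertices of the product; the list collects them, and a map fixing
    their coordinates leaves all labels unchanged. *)
Lemma gp_shift_fix (G : V -> groupType) (s : dprodg G) a :
  exists l : seq (dprodg G), forall f : forall v, G v -> G v,
    (forall t, t \in l -> forall v, f v (t v) = t v) -> gp_shift f s a = a.
Proof.
elim/gp_ind: a s => [|w x a IH] s.
  by exists [::] => f _; rewrite gp_shift1.
have [l lP] := IH (s * gp_pos (gp_in E x)).
exists [:: s, s * dprodg_in x & l] => f fP.
rewrite gp_shiftM lP => [|t tl v]; last by apply: fP; rewrite !inE tl !orbT.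
rewrite gp_shift_in; have -> : s w * x = (s * dprodg_in x) w.
  by rewrite dprodgM dprodg_in_same.
rewrite !fP ?inE ?eqxx ?orbT //.
by rewrite dprodgM dprodg_in_same mulKg.
Qed.

Lemma gp_shift_id (G : V -> groupType) (f : forall v, G v -> G v) s a :
  (forall v x, f v x = x) -> gp_shift f s a = a.
Proof. by move=> fP; have [l lP] := gp_shift_fix s a; exact: lP. Qed.

(** The retraction is required only along the image of [psi], so that [f] may fail to be injective
    away from the vertices visited there. *)
Lemma gp_shift_embedding (P : groupType) (G G' : V -> groupType)
    (f : forall v, G v -> G' v) (r : forall v, G' v -> G v)
    (psi : P -> graph_product E G) :
  {morph psi : x y / x * y} -> injective psi -> (forall v, f v 1 = 1) ->
  (forall v, {morph f v : x y / x * y} \/ forall p, gp_pos (psi p) v = 1) ->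
  (forall p, gp_shift (fun v x => r v (f v x)) 1 (psi p) = psi p) ->
  exists chi : P -> graph_product E G', [/\ {morph chi : x y / x * y},
    injective chi & forall p v, gp_pos (chi p) v = f v (gp_pos (psi p) v)].
Proof.
move=> psiM psi_inj f1 fM rf; pose chi p := gp_shift f 1 (psi p).
have chiM : {morph chi : x y / x * y}.
  move=> p q; rewrite /chi psiM gp_shiftM; congr (_ * _).
  (* The path of [psi p] closes up wherever [f v] is not a morphism, so the second factor may be
     read from [1] again. *)
  apply: gp_shift_start => v; have [?|e] := fM v; [by left|right].
  by rewrite dprodgM e mulg1.
exists chi; split=> //.
- apply: morph_injective => // p chip; apply: psi_inj.
  rewrite (morph_group1 psiM) -rf -gp_shift_comp -/(chi p) chip.
  exact: gp_shift1.
- by move=> p v; rewrite gp_pos_shift f1 invg1 !mul1g.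
Qed.

End Shift.

Section GeneratedSubgroups.
Local Open Scope group_scope.
Variables (G : groupType) (A : set G).

Lemma sub_generated : A `<=` generated A.
Proof. by move=> x Ax H [_]; exact. Qed.

Lemma generated_min (H : set G) : is_subgroup H -> A `<=` H -> generated A `<=` H.
Proof. by move=> sH AH x; apply. Qed.

Lemma is_normal_derived : is_normal (generated (@commutators G)).
Proof.
have sD := is_subgroup_generated (@commutators G); split=> // x g Dx.
have -> : x ^ g = x * [~ x, g] by rewrite /commg mulVKg.
case: sD => _ DM _; apply: (DM) => //.
by move=> H [_]; apply; exists x, g.
Qed.

End GeneratedSubgroups.

Lemma big_commuteM (G : groupType) (I : Type) (s : seq I) (F1 F2 : I -> G) :
  (forall i j, commute (F1 i) (F2 j)) ->
  (\prod_(i <- s) (F1 i * F2 i) = (\prod_(i <- s) F1 i) * \prod_(i <- s) F2 i)%g.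
Proof.
move=> F12; elim: s => [|i s IH]; first by rewrite !big_nil mulg1.
have sC : commute (F2 i) (\prod_(j <- s) F1 j)%g.
  by elim: s {IH} => [|j s IH]; rewrite ?big_nil ?big_cons;
    [exact: commute1|apply: commuteM => //; apply/commute_sym].
by rewrite !big_cons IH -!mulgA; congr (_ * _)%g; rewrite !mulgA sC.
Qed.

(** * The derived subgroup as a kernel *)

Section DerivedSubgroup.
Local Open Scope group_scope.
Variables (V : finType) (E : rel V) (E_irr : irreflexive E) (G : V -> groupType).
Local Notation GP := (graph_product E G).

Lemma derived_gp_pos (a : GP) :
  (forall v (x y : G v), commute x y) -> generated (@commutators GP) a -> gp_pos a = 1.
Proof.
move=> G_abelian; have posM := @gp_posM V E E_irr G.
apply: (@generated_min _ _ [set a | gp_pos a = 1]).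
  by have [] := is_normal_kernel posM.
move=> _ [x [y ->]] /=; rewrite (morph_groupR posM).
apply/eqP/commgP; apply: functional_extensionality_dep => v.
by rewrite !dprodgM; exact: G_abelian.
Qed.

(** Modulo commutators the letters of a word can be sorted by vertex, so the class of [a] depends
    only on its coordinates. *)
Lemma gp_pos_derived (a : GP) : gp_pos a = 1 -> generated (@commutators GP) a.
Proof.
move=> a1; set nD := is_normal_derived GP.
pose c : GP -> quotient_group nD := @pg_class _ (quotient_pregroup nD).
have cM : {morph c : x y / x * y} by move=> x y; exact: pg_classM.
have cC x y : commute (c x) (c y).
  apply/commgP/eqP; rewrite -(morph_groupR cM) -[RHS](morph_group1 cM).
  apply/pg_classP; rewrite /= mulg1.
  have [[_ _ DV] _] := nD; apply: DV.
  by apply: sub_generated; exists x, y.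
suff: c a = \prod_(v <- index_enum V) c (gp_in E (gp_pos a v)).
  rewrite a1 big1 => [|v _]; last by rewrite gp_in1 (morph_group1 cM).
  rewrite -(morph_group1 cM) => /pg_classP /=; rewrite mulg1.
  by have [[_ _ DV] _] := nD => /DV; rewrite invgK.
elim/gp_ind: a {a1} => [|w x a IH].
  rewrite (morph_group1 cM) (morph_group1 (@gp_posM V E E_irr G)).
  by rewrite big1 // => v _; rewrite gp_in1 (morph_group1 cM).
have posE v : c (gp_in E (gp_pos (gp_in E x * a) v)) =
    c (gp_in E (dprodg_in x v)) * c (gp_in E (gp_pos a v)).
  by rewrite (gp_posM E_irr) gp_pos_in // dprodgM gp_inM cM.
rewrite (eq_bigr _ (fun v _ => posE v)) big_commuteM //.
rewrite cM IH; congr (_ * _).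
have single s : uniq s ->
    \prod_(v <- s) c (gp_in E (dprodg_in x v)) =
    if w \in s then c (gp_in E x) else 1.
  elim: s => [|v s IHs]; first by rewrite big_nil.
  rewrite big_cons inE => /= /andP[vs /IHs ->].
  have [wv|wv] := eqVneq w v; last first.
    by rewrite dprodg_in_diff // gp_in1 (morph_group1 cM) mul1g.
  by subst v; rewrite (negbTE vs) mulg1 dprodg_in_same.
by rewrite single ?index_enum_uniq // mem_index_enum.
Qed.

End DerivedSubgroup.

(** * Finite and cyclic vertex groups *)

Section FiniteGroups.
Local Open Scope group_scope.

(** Putting [1] at the head of the enumeration gives it index 0, which makes the injection
    pointed. *)
Lemma finite_group_enum (H : groupType) : finite_group H ->
  exists n (f : H -> nat) (r : nat -> H),
    [/\ f 1 = 0%N, forall x, (f x < n)%N & cancel f r].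
Proof.
move=> /finite_seqP[s sE].
exists (size s).+1, (fun x => index x (1 :: s)), (nth 1 (1 :: s)).
have mem x : x \in 1 :: s.
  have : [set: H] x by [].
  by rewrite sE inE => /= ->; rewrite orbT.
split=> [|x|x]; first by rewrite /= eqxx.
- by have := mem x; rewrite -index_mem.
- exact: nth_index.
Qed.

(** All large moduli are allowed, so that one [m] can serve every vertex. *)
Lemma finite_group_Zp (H : groupType) : finite_group H ->
  exists n, forall m, (1 < m)%N -> (n <= m)%N ->
  exists (f : H -> Algebra.to_multiplicative 'Z_m)
         (r : Algebra.to_multiplicative 'Z_m -> H), f 1 = 1 /\ cancel f r.
Proof.
move=> /finite_group_enum[n [f [r [f1 fn fK]]]].
exists n => m m1 nm; exists (fun x => (f x)%:R : 'Z_m)%R.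
exists (fun k : 'Z_m => r k); split=> [|x]; first by rewrite f1.
by rewrite val_Zp_nat // modn_small ?fK // (leq_trans (fn x)).
Qed.

Lemma finite_group_int (H : groupType) : finite_group H ->
  exists (f : H -> Algebra.to_multiplicative int)
         (r : Algebra.to_multiplicative int -> H), f 1 = 1 /\ cancel f r.
Proof.
move=> /finite_group_enum[n [f [r [f1 fn fK]]]].
by exists (fun x => Posz (f x)), (fun k : int => r `|k|%N); rewrite f1.
Qed.

Lemma finite_quotient_kernel (G H : groupType) (f : G -> H)
    (fM : {morph f : x y / x * y}) :
  finite_group H -> finite_group (quotient_group (is_normal_kernel fM)).
Proof.
move=> finH; set Q := quotient_group _.
pose g (a : Q) : H := f (pg_repr a).
have g_inj : {in g @^-1` setT &, injective g}.
  move=> a b _ _ gab; rewrite -(pg_reprK a) -(pg_reprK b); apply/pg_classP => /=.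
  by rewrite fM (morph_groupV fM) -!/(g _) gab mulVg.
exact: (finite_preimage g_inj finH).
Qed.

(** The power map [z] on the integers is onto. If it is injective, its inverse is the required
    morphism; otherwise it has a positive period [n] and the exponents below [n] exhaust the
    group. *)
Lemma cyclic_group_int (H : groupType) : cyclic_group H ->
  finite_group H \/
  exists (f : H -> Algebra.to_multiplicative int)
         (r : Algebra.to_multiplicative int -> H),
    {morph f : x y / x * y} /\ cancel f r.
Proof.
case=> g gH; pose z (k : int) : H := if k is Negz n then g ^- n.+1 else g ^+ `|k|%N.
have zS k : z (k + 1)%R = z k * g.
  case: k => [n|[|n]].
  - by rewrite -PoszD addn1 /z !absz_nat expgSr.
  - by rewrite (_ : Negz 0 + 1 = 0)%R // /z /= expg1 mulVg.
  - have -> : (Negz n.+1 + 1)%R = Negz n by rewrite !NegzE; lia.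
    by rewrite /z [g ^+ n.+2]expgS invgM mulgVK.
have zB k : z (k - 1)%R = z k * g^-1.
  by rewrite -[in RHS](subrK 1%R k) zS mulgK.
have zD k l : z (k + l)%R = z k * z l.
  elim/int_rect: l => [|n IH|n IH].
  - by rewrite addr0 /z /= mulg1.
  - by rewrite -addn1 PoszD addrA !zS IH mulgA.
  - by rewrite -addn1 PoszD opprD addrA !zB IH mulgA.
have z0 : z 0%R = 1 by [].
have z_surj x : range z x.
  have : generated [set g] x by rewrite gH.
  apply: (@generated_min _ _ (range z)) => [|_ ->]; last first.
    by exists 1%R; rewrite // /z /= expg1.
  split=> [|_ _ [k _ <-] [l _ <-]|_ [k _ <-]]; first by exists 0%R.
  - by exists (k + l)%R.
  - by exists (- k)%R => //; apply: (mulgI (z k)); rewrite -zD subrr mulgV.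
have [z_inj|/existsNP[k /existsNP[l /not_implyP[zkl kl]]]] :=
    pselect (forall k l, z k = z l -> k = l).
  right; have /choice[f fP] : forall x, exists k, z k = x.
    by move=> x; have [k _ <-] := z_surj x; exists k.
  exists f, z; split=> // x y; apply: z_inj.
  by rewrite [LHS]fP [RHS]zD !fP.
left.
have [n n0 zn] : exists2 n : nat, (0 < n)%N & z n = 1.
  wlog lk : k l zkl kl / (l <= k)%R.
    by move=> h; have [/h|/ltW/h] := leP l k; [exact|apply=> // e; exact: kl].
  exists `|k - l|%N; first by rewrite absz_gt0 subr_eq0; exact/eqP.
  rewrite gez0_abs ?subr_ge0 // zD zkl -zD subrr.
  exact: z0.
apply: (@sub_finite_set _ _ ((fun i : nat => z i) @` `I_n)); last first.
  by apply: finite_image; exact: finite_II.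
move=> x _; have [k' _ <-] := z_surj x.
have zq q : z (q * Posz n)%R = 1.
  elim/int_rect: q => [|q IH|q IH].
  - by rewrite mul0r.
  - by rewrite -addn1 PoszD mulrDl mul1r zD IH zn mulg1.
  - rewrite -addn1 PoszD opprD mulrBl mul1r zD IH mul1g.
    by apply: (mulgI (z n)); rewrite -zD subrr z0 zn mulg1.
have n0' : Posz n != 0%R by rewrite eqz_nat -lt0n.
have kn : Posz `|(k' %% n)%Z|%N = (k' %% n)%Z by rewrite gez0_abs ?modz_ge0.
exists `|(k' %% n)%Z|%N.
  by rewrite /= -ltz_nat kn ltz_pmod.
by rewrite kn -[LHS]mul1g -(zq (k' %/ n)%Z) -zD -divz_eq.
Qed.

End FiniteGroups.

(** * Paths and fundamental groups *)

Section LocallyConstant.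

Lemma connected_locally_constant (X : topologicalType) (P : set X) :
  connected [set: X] -> (forall x, \forall y \near x, P x <-> P y) ->
  forall x y, P x -> P y.
Proof.
move=> cX PX x y Px.
have oP : open P.
  rewrite openE => z Pz; apply: filterS (PX z) => w [h _]; exact: h.
have oPc : open (~` P).
  rewrite openE => z nPz; apply: filterS (PX z) => w [_ h] /h; exact: nPz.
suff -> : P = setT by [].
apply: cX; first by exists x.
- by exists P => //; rewrite setTI.
- by exists P; rewrite ?setTI // -openC.
Qed.

Lemma connected_real (R : realType) : connected [set: R].
Proof. by apply/connected_intervalP => x y _ _ z _. Qed.

End LocallyConstant.

(** * Homotopy of paths with fixed end points *)

Section Paths.
Local Open Scope ring_scope.
Variables (R : realType) (S : topologicalType).
Implicit Types (p q r : R -> S) (U : set S).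
Local Notation I01 := `[0, 1]%classic.

(** Continuity is asked on the whole plane rather than on the square, so that homotopies compose and
    lift without subspace topologies. *)
Definition path_homotopic p q := exists H : R * R -> S,
  [/\ continuous H,
      forall s, I01 s -> H (s, 0) = p s /\ H (s, 1) = q s &
      forall t, I01 t -> H (0, t) = p 0 /\ H (1, t) = p 1].

Definition convex_comb (z w : R * R) (t : R) : R * R :=
  ((1 - t) * z.1 + t * w.1, (1 - t) * z.2 + t * w.2).

Lemma convex_comb0 z w : convex_comb z w 0 = z.
Proof. by rewrite /convex_comb !mul0r !addr0 subr0 !mul1r; case: z. Qed.

Lemma convex_comb1 z w : convex_comb z w 1 = w.
Proof. by rewrite /convex_comb subrr !mul0r !add0r !mul1r; case: w. Qed.

Lemma convex_combxx z t : convex_comb z z t = z.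
Proof. by rewrite /convex_comb -!mulrDl !subrK !mul1r; case: z. Qed.

Lemma continuous_convex_comb (X : topologicalType) (a b : X -> R * R)
    (c : X -> R) :
  continuous a -> continuous b -> continuous c ->
  continuous (fun x => convex_comb (a x) (b x) (c x)).
Proof.
move=> ca cb cc.
have c1 : continuous (fun x => 1 - c x).
  by apply: continuous_addf; [exact: continuous_cstf|exact: continuous_oppf].
have fstC (f : X -> R * R) : continuous f -> continuous (fun x => (f x).1).
  by move=> cf; exact: (continuous_compf cf (@continuous_fst R)).
have sndC (f : X -> R * R) : continuous f -> continuous (fun x => (f x).2).
  by move=> cf; exact: (continuous_compf cf (@continuous_snd R)).
by apply: continuous_pairf; apply: continuous_addf; apply: continuous_mulf => //;
  (exact: fstC || exact: sndC).
Qed.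

Definition convex2 (C : set (R * R)) :=
  forall z w t, C z -> C w -> I01 t -> C (convex_comb z w t).

(** The straight-line homotopy from [a] to [b] stays in [C] and is pushed forward by [h]. *)
Lemma path_homotopic_convex (C : set (R * R)) (h : R * R -> S)
    (a b : R -> R * R) p q :
  convex2 C -> {within C, continuous h} -> continuous a -> continuous b ->
  (forall s, C (a s)) -> (forall s, C (b s)) -> a 0 = b 0 -> a 1 = b 1 ->
  (forall s, I01 s -> p s = h (a s)) -> (forall s, I01 s -> q s = h (b s)) ->
  path_homotopic p q.
Proof.
move=> cC ch ca cb Ca Cb ab0 ab1 pE qE.
exists (fun z => h (convex_comb (a z.1) (b z.1) (clamp z.2))); split.
- apply: (continuous_within_comp ch) => [|z]; last first.
    by apply: cC => //; exact: clamp_itv.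
  apply: continuous_convex_comb.
  + by apply: continuous_compf ca; exact: continuous_fst.
  + by apply: continuous_compf cb; exact: continuous_fst.
  + by exact: (continuous_compf (@continuous_snd R) (@continuous_clamp R)).
- by move=> s Is /=; rewrite clamp0 clamp1 convex_comb0 convex_comb1 pE ?qE.
- move=> t It /=; rewrite -ab0 -ab1 !convex_combxx !pE //; first exact: I1.
  exact: I0.
Qed.

Lemma path_homotopic_reparam (h : R -> S) (a b : R -> R) p q :
  continuous h -> continuous a -> continuous b -> a 0 = b 0 -> a 1 = b 1 ->
  (forall s, I01 s -> p s = h (a s)) -> (forall s, I01 s -> q s = h (b s)) ->
  path_homotopic p q.
Proof.
move=> ch ca cb ab0 ab1 pE qE.
apply: (@path_homotopic_convex setT (fun z => h z.1) (fun s => (a s, 0))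
  (fun s => (b s, 0))) => //.
- apply: continuous_subspaceT.
  by apply: continuous_compf ch; exact: continuous_fst.
- by apply: continuous_pairf => //; exact: continuous_cstf.
- by apply: continuous_pairf => //; exact: continuous_cstf.
- by rewrite ab0.
- by rewrite ab1.
Qed.

Lemma path_homotopic_eq p q : continuous p -> (forall s, I01 s -> p s = q s) ->
  path_homotopic p q.
Proof.
move=> cp pq; apply: (@path_homotopic_reparam p id id) => //.
- exact: continuous_idf.
- exact: continuous_idf.
- by move=> s /pq.
Qed.

Lemma path_homotopic_refl p : continuous p -> path_homotopic p p.
Proof. by move=> cp; exact: path_homotopic_eq. Qed.

Lemma path_homotopic_ends p q : path_homotopic p q -> p 0 = q 0 /\ p 1 = q 1.
Proof.
case=> H [_ Hs Ht].
have [h0 h1] := Ht 1 (I1 R).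
by rewrite -h0 -h1 (Hs 0 (I0 R)).2 (Hs 1 (I1 R)).2.
Qed.

Lemma path_homotopic_sym p q : path_homotopic p q -> path_homotopic q p.
Proof.
move=> pq; have [e0 e1] := path_homotopic_ends pq.
case: pq => H [cH Hs Ht]; exists (fun z => H (z.1, - 1 * z.2 + 1)); split.
- apply: continuous_compf cH; apply: continuous_pairf; first exact: continuous_fst.
  by apply: continuous_affine; exact: continuous_snd.
- move=> s Is /=; have [h0 h1] := Hs _ Is.
  by rewrite mulr0 add0r mulr1 addNr.
move=> t /I01P[t0 t1] /=.
have It : I01 (- 1 * t + 1) by apply/I01P; split; lra.
by rewrite -e0 -e1; exact: Ht.
Qed.

Lemma path_homotopic_trans p q r :
  path_homotopic p q -> path_homotopic q r -> path_homotopic p r.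
Proof.
move=> pq; have [e0 e1] := path_homotopic_ends pq.
case: pq => H [cH Hs Ht] [K [cK Ks Kt]].
exists (fun z => if z.2 <= 2^-1 then H (clamp z.1, 2 * z.2 + 0)
                 else K (clamp z.1, 2 * z.2 + - 1)); split.
- have cc : continuous (fun z : R * R => clamp z.1).
    by exact: (continuous_compf (@continuous_fst R) (@continuous_clamp R)).
  apply: continuous_paste; first exact: continuous_snd.
  + apply: continuous_compf cH; apply: continuous_pairf => //.
    by apply: continuous_affine; exact: continuous_snd.
  + apply: continuous_compf cK; apply: continuous_pairf => //.
    by apply: continuous_affine; exact: continuous_snd.
  move=> [s t] /= ->; rewrite (_ : 2 * 2^-1 + 0 = 1 :> R); last by lra.
  rewrite (_ : 2 * 2^-1 + - 1 = 0 :> R); last by lra.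
  by rewrite (Hs _ (clamp_itv s)).2 (Ks _ (clamp_itv s)).1.
- move=> s Is /=; have [h0 h1] := Hs _ Is; have [k0 k1] := Ks _ Is.
  rewrite ifT ?invr_ge0 // ifF; last by apply/negbTE; rewrite -ltNge; lra.
  rewrite mulr0 addr0 (_ : 2 * 1 + - 1 = 1 :> R); last by lra.
  by rewrite clamp_id.
move=> t /I01P[t0 t1] /=; rewrite clamp0 clamp1.
case: leP => h.
  by apply: Ht; apply/I01P; split; lra.
by rewrite e0 e1; apply: Kt; apply/I01P; split; lra.
Qed.

Lemma continuous_concat p q :
  continuous p -> continuous q -> p 1 = q 0 -> continuous (concat p q).
Proof.
move=> cp cq pq.
have -> : concat p q = (fun s => if s <= 2^-1 then p (2 * s + 0) else q (2 * s + - 1)).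
  by apply/funext => s; rewrite /concat addr0.
apply: continuous_paste; first exact: continuous_idf.
- by apply: continuous_compf cp; exact: continuous_affine1.
- by apply: continuous_compf cq; exact: continuous_affine1.
move=> s ->; rewrite (_ : 2 * 2^-1 + 0 = 1 :> R); last by lra.
by rewrite (_ : 2 * 2^-1 + - 1 = 0 :> R); last by lra.
Qed.

Lemma concat0 p q : concat p q 0 = p 0.
Proof. by rewrite /concat ifT ?mulr0 // invr_ge0. Qed.

Lemma concat1 p q : concat p q 1 = q 1.
Proof.
rewrite /concat ifF; last by apply/negbTE; rewrite -ltNge; lra.
by rewrite (_ : 2 * 1 - 1 = 1) //; lra.
Qed.

Lemma concat_in U p q :
  (forall s, U (p s)) -> (forall s, U (q s)) -> forall s, U (concat p q s).
Proof. by move=> Up Uq s; rewrite /concat; case: ifP. Qed.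

Lemma continuous_reverse p : continuous p -> continuous (reverse p).
Proof.
move=> cp; apply: continuous_compf cp => s.
by apply: cvgD; [exact: cvg_cst|apply: cvgN; exact: cvg_id].
Qed.

Lemma reverse0 p : reverse p 0 = p 1.
Proof. by rewrite /reverse subr0. Qed.

Lemma reverse1 p : reverse p 1 = p 0.
Proof. by rewrite /reverse subrr. Qed.

Lemma path_homotopic_concat p p' q q' : p 1 = q 0 ->
  path_homotopic p p' -> path_homotopic q q' ->
  path_homotopic (concat p q) (concat p' q').
Proof.
move=> pq [H [cH Hs Ht]] [K [cK Ks Kt]].
exists (fun z => if z.1 <= 2^-1 then H (2 * z.1 + 0, clamp z.2)
                 else K (2 * z.1 + - 1, clamp z.2)); split.
- have cc : continuous (fun z : R * R => clamp z.2).
    by exact: (continuous_compf (@continuous_snd R) (@continuous_clamp R)).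
  apply: continuous_paste; first exact: continuous_fst.
  + apply: continuous_compf cH; apply: continuous_pairf => //.
    by apply: continuous_affine; exact: continuous_fst.
  + apply: continuous_compf cK; apply: continuous_pairf => //.
    by apply: continuous_affine; exact: continuous_fst.
  move=> [s t] /= ->; rewrite (_ : 2 * 2^-1 + 0 = 1 :> R); last by lra.
  rewrite (_ : 2 * 2^-1 + - 1 = 0 :> R); last by lra.
  by rewrite (Ht _ (clamp_itv t)).2 (Kt _ (clamp_itv t)).1.
- move=> s /I01P[s0 s1] /=; rewrite clamp0 clamp1 /concat addr0; case: leP => hs.
  + by apply: Hs; apply/I01P; split; lra.
  + by apply: Ks; apply/I01P; split; lra.
move=> t It /=; rewrite concat0 concat1 ifT ?invr_ge0 // ifF; last first.
  by apply/negbTE; rewrite -ltNge; lra.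
rewrite mulr0 addr0 (_ : 2 * 1 + - 1 = 1 :> R); last by lra.
by rewrite clamp_id // (Ht _ It).1 (Kt _ It).2.
Qed.

Lemma path_homotopic_concatA p q r :
  continuous p -> continuous q -> continuous r -> p 1 = q 0 -> q 1 = r 0 ->
  path_homotopic (concat p (concat q r)) (concat (concat p q) r).
Proof.
move=> cp cq cr pq qr.
(* The change of parameter between the two bracketings has slopes 2, 1 and 1/2 in turn; being
   concave, it is the minimum of its affine pieces. *)
pose psi (s : R) :=
  Num.min (2 * s + 0) (Num.min (1 * s + 4^-1) (2^-1 * s + 2^-1)).
have cpsi : continuous psi.
  apply: continuous_minf; first exact: continuous_affine1.
  by apply: continuous_minf; exact: continuous_affine1.
have psiP s : [/\ psi s <= 2 * s + 0, psi s <= 1 * s + 4^-1,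
    psi s <= 2^-1 * s + 2^-1 & [\/ psi s = 2 * s + 0,
    psi s = 1 * s + 4^-1 | psi s = 2^-1 * s + 2^-1]] by exact: min3P.
move: psi cpsi psiP => psi cpsi psiP.
have psi0 : psi 0 = 0 by have [? ? ? []?] := psiP 0; lra.
have psi1 : psi 1 = 1 by have [? ? ? []?] := psiP 1; lra.
apply: (@path_homotopic_reparam (concat p (concat q r)) id psi);
  rewrite ?psi0 ?psi1 //.
- by apply: continuous_concat; rewrite ?concat0 //; exact: continuous_concat.
- exact: continuous_idf.
move=> s /I01P[s0 s1]; rewrite /concat.
have [hle1 hle2 hle3 hor] := psiP s.
case: (leP s 2^-1) => h1; last first.
  have -> : psi s = 2^-1 * s + 2^-1 by case: hor => ?; lra.
  by rewrite !ifF; [congr (r _); lra|apply/negbTE; rewrite -ltNge; lra..].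
case: (leP (2 * s) 2^-1) => h2.
  have -> : psi s = 2 * s by case: hor => ?; lra.
  by rewrite ifT.
have -> : psi s = s + 4^-1 by case: hor => ?; lra.
rewrite ifF; last by apply/negbTE; rewrite -ltNge; lra.
by rewrite ifT; [congr (q _); lra|lra].
Qed.

Lemma path_homotopic_concat1 (x : S) p : continuous p -> p 0 = x ->
  path_homotopic (concat (fun=> x) p) p.
Proof.
move=> cp <-.
pose phi (s : R) := Num.max 0 (2 * s + - 1).
have phi0 : phi 0 = 0.
  by have /= [? ? []?] := max2P 0 (2 * 0 + - 1 : R); rewrite /phi; lra.
have phi1 : phi 1 = 1.
  by have /= [? ? []?] := max2P 0 (2 * 1 + - 1 : R); rewrite /phi; lra.
apply: (@path_homotopic_reparam p phi id) => //.
- by apply: continuous_maxf; [exact: continuous_cstf|exact: continuous_affine1].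
- exact: continuous_idf.
move=> s /I01P[s0 s1]; rewrite /concat /phi; case: leP => h.
- by rewrite max_l //; lra.
- by rewrite max_r //; lra.
Qed.

Lemma path_homotopic_concatVx p : continuous p ->
  path_homotopic (concat (reverse p) p) (fun=> p 1).
Proof.
(* The path is run backwards, then forwards: the parameter is the absolute value of [2 * s - 1]. *)
move=> cp; pose phi (s : R) := Num.max (- 2 * s + 1) (2 * s + - 1).
have phi0 : phi 0 = 1.
  by have /= [? ? []?] := max2P (- 2 * 0 + 1 : R) (2 * 0 + - 1); rewrite /phi; lra.
have phi1 : phi 1 = 1.
  by have /= [? ? []?] := max2P (- 2 * 1 + 1 : R) (2 * 1 + - 1); rewrite /phi; lra.
apply: (@path_homotopic_reparam p phi (fun=> 1)) => //.
- by apply: continuous_maxf; exact: continuous_affine1.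
- exact: continuous_cstf.
move=> s /I01P[s0 s1]; rewrite /= /concat /reverse /phi; case: leP => h.
- by rewrite max_l; [congr (p _); lra|lra].
- by rewrite max_r //; lra.
Qed.

End Paths.

(** * Simply connected neighbourhoods *)

Section Discs.
Local Open Scope ring_scope.
Variables (R : realType) (S : topologicalType).
Implicit Types (U W : set S).
Local Notation I01 := `[0, 1]%classic.

(** The homotopy may leave [U]: only the homotopy class in [S] of a path matters for monodromy. *)
Definition disc U := [/\ open U,
  forall y z, U y -> U z -> exists p : R -> S,
    [/\ continuous p, forall s, U (p s), p 0 = y & p 1 = z] &
  forall p q : R -> S, continuous p -> continuous q ->
    (forall s, U (p s)) -> (forall s, U (q s)) -> p 0 = q 0 -> p 1 = q 1 ->
    path_homotopic p q].

Lemma convex2_ball (z : R * R) (e : R) : convex2 (ball z e).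
Proof.
move=> w w' t [] + + [] + + /I01P[t0 t1].
rewrite /ball /= => a1 a2 b1 b2.
have comb (x u v : R) : `|x - u| < e -> `|x - v| < e ->
    `|x - ((1 - t) * u + t * v)| < e.
  rewrite !ltr_norml => /andP[xu1 xu2] /andP[xv1 xv2].
  have [->|tn0] := eqVneq t 0; first by rewrite subr0 mul1r mul0r addr0 xu1.
  have tp : 0 < t by rewrite lt_neqAle eq_sym tn0.
  have t1' : 0 <= 1 - t by rewrite subr_ge0.
  have u1 : 0 <= (1 - t) * (e + (x - u)) by apply: mulr_ge0 => //; lra.
  have u2 : 0 <= (1 - t) * (e - (x - u)) by apply: mulr_ge0 => //; lra.
  have v1 : 0 < t * (e + (x - v)) by apply: mulr_gt0 => //; lra.
  have v2 : 0 < t * (e - (x - v)) by apply: mulr_gt0 => //; lra.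
  by apply/andP; split; nra.
by split; rewrite /ball /=; exact: comb.
Qed.

Lemma continuous_within_open (X Y : topologicalType) (A : set X) (f : X -> Y) x :
  open A -> {within A, continuous f} -> A x -> {for x, continuous f}.
Proof.
move=> oA /subspace_continuousP cf Ax W /(cf _ Ax) nW.
have : nbhs x A by exact: open_nbhs_nbhs.
have {}nW : nbhs x [set y | A y -> W (f y)] by [].
by move=> nA; apply: filterS (filterI nW nA) => y [h /h].
Qed.

(** The inverse image of a small ball under the chart works, because the ball is convex. *)
Lemma hyp_chart_disc (c : chart R S) x W :
  is_hyp_chart c -> chart_dom c x -> nbhs x W ->
  exists2 U, disc U & U x /\ U `<=` W.
Proof.
case=> oD _ cc inj_c open_c Dx nW.
set D := chart_dom c in oD cc inj_c open_c Dx; set f := chart_map c in cc inj_c open_c.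
pose O := W^° `&` D.
have oO : open O by apply: openI => //; exact: open_interior.
have Ox : O x by split.
have nfx : nbhs (f x) (f @` O).
  apply: open_nbhs_nbhs; split; last by exists x.
  by apply: open_c => // y [].
have [e e0 eB] : exists2 e : R, 0 < e & ball (f x) e `<=` f @` O.
  by move/nbhs_ballP: nfx => [e /= e0 ?]; exists e.
pose B : set (R * R) := ball (f x) e.
have oB : open B by exact: ball_open.
have Bfx : B (f x) by exact: ballxx.
(* [h] inverts the chart on the ball, with junk value [x] elsewhere; it is continuous on the ball
   because charts are open maps. *)
have /choice[h hP] : forall z, exists y, B z -> O y /\ f y = z.
  move=> z.
  have [Bz|nBz] := pselect (B z); last by exists x.
  by have [y Oy yz] := eB _ Bz; exists y.
have hK y : O y -> B (f y) -> h (f y) = y.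
  move=> Oy /hP[[_ Dh] fh]; apply: inj_c; rewrite ?inE //.
  by case: Oy.
have ch : {within B, continuous h}.
  apply/subspace_continuousP => z Bz N nN.
  have [Oh fh] := hP _ Bz.
  have oN : open (f @` (N^° `&` O)).
    by apply: open_c; [apply: openI => //; exact: open_interior|move=> y [_ []]].
  have nz : nbhs z (f @` (N^° `&` O)).
    by apply: open_nbhs_nbhs; split=> //; exists (h z) => //; split=> //.
  rewrite /= /nbhs /= /within /=; near=> w => Bw.
  have [y [Ny Oy] yw] : (f @` (N^° `&` O)) w by near: w.
  change (N (h w)); rewrite -yw hK //; last by rewrite yw.
  exact: interior_subset Ny.
pose U := O `&` f @^-1` B.
have oU : open U.
  rewrite openE => y [Oy By]; apply: filterI; first exact: open_nbhs_nbhs.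
  have : nbhs (f y) B by exact: open_nbhs_nbhs.
  apply: (continuous_within_open oD cc).
  by case: Oy.
have Uh z : B z -> U (h z).
  by move=> Bz; have [Oh fh] := hP _ Bz; split; rewrite /= ?fh.
have cB : convex2 B by exact: convex2_ball.
have cfp (p : R -> S) : continuous p -> (forall s, U (p s)) -> continuous (f \o p).
  move=> cp Up; apply: (continuous_within_comp cc) => // s.
  by have [[_ ?] _] := Up s.
exists U; last by split=> // y [[/interior_subset]].
split=> // [y z Uy Uz|p q cp cq Up Uq p0 p1].
(* Paths are functions on the whole line and must stay in [U] for every parameter, hence [clamp]. *)
- exists (fun s => h (convex_comb (f y) (f z) (clamp s))); split.
  + apply: (continuous_within_comp ch) => [|s]; last first.
      by apply: cB; [case: Uy|case: Uz|exact: clamp_itv].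
    apply: continuous_convex_comb; first exact: continuous_cstf.
      exact: continuous_cstf.
    exact: continuous_clamp.
  + by move=> s; apply/Uh/cB; [case: Uy|case: Uz|exact: clamp_itv].
  + by rewrite clamp0 convex_comb0 hK //; case: Uy.
  + by rewrite clamp1 convex_comb1 hK //; case: Uz.
apply: (@path_homotopic_convex _ _ B h (f \o p) (f \o q)) => //.
- exact: cfp.
- exact: cfp.
- by move=> s; have [] := Up s.
- by move=> s; have [] := Uq s.
- by rewrite /= p0.
- by rewrite /= p1.
- by move=> s _ /=; rewrite hK //; have [] := Up s.
- by move=> s _ /=; rewrite hK //; have [] := Uq s.
Unshelve. all: by end_near. Qed.

Definition locally_disc := forall x W, nbhs x W ->
  exists2 U, disc U & U x /\ U `<=` W.

Lemma hyperbolic_locally_disc : closed_hyperbolic_surface R S -> locally_disc.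
Proof.
move=> [_ _ _ _ [A [hA covA _]]] x W nW.
by have [c /hA hc cx] := covA x; exact: hyp_chart_disc hc cx nW.
Qed.

(** Being reachable from [x] is locally constant, since points of a disc are joined inside it. *)
Lemma connected_path_connected : connected [set: S] -> locally_disc ->
  forall x y, exists p : R -> S, [/\ continuous p, p 0 = x & p 1 = y].
Proof.
move=> cS dS x y.
apply: (@connected_locally_constant _ (fun y => exists p : R -> S,
  [/\ continuous p, p 0 = x & p 1 = y]) cS _ x y).
- move=> z; have [U [oU Up _] [Uz _]] := dS z setT filterT.
  have : nbhs z U by exact: open_nbhs_nbhs.
  apply: filterS => w Uw.
  have join (u v : S) : U u -> U v ->
      (exists p : R -> S, [/\ continuous p, p 0 = x & p 1 = u]) ->
      exists p : R -> S, [/\ continuous p, p 0 = x & p 1 = v].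
    move=> Uu Uv [p [cp p0 p1]]; have [q [cq _ q0 q1]] := Up _ _ Uu Uv.
    exists (concat p q); rewrite concat0 concat1; split=> //.
    by apply: continuous_concat => //; rewrite p1.
  by split; exact: join.
- by exists (fun=> x); split=> //; exact: continuous_cstf.
Qed.

(** The path chosen for [x0] itself is constant, so that closing up a loop at [x0] does not alter
    its class. *)
Lemma base_paths (x0 : S) : connected [set: S] -> locally_disc ->
  exists g : S -> R -> S, [/\ forall y, continuous (g y), forall y, g y 0 = x0,
    forall y, g y 1 = y & g x0 = fun=> x0].
Proof.
move=> cS dS.
have /choice[g gP] : forall y, exists p : R -> S,
    [/\ continuous p, p 0 = x0, p 1 = y & y = x0 -> p = fun=> x0].
  move=> y; have [->|yx] := pselect (y = x0).
    by exists (fun=> x0); split=> //; exact: continuous_cstf.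
  by have [p [cp p0 p1]] := connected_path_connected cS dS x0 y; exists p.
exists g; split=> [y|y|y|]; try by have [] := gP y.
by have [_ _ _] := gP x0; exact.
Qed.

End Discs.

(** * Classes of loops and transport along paths *)

Section LoopClass.
Local Open Scope ring_scope.
Variables (R : realType) (S : topologicalType) (x0 : S).
Implicit Types p q : R -> S.
Local Notation I01 := `[0, 1]%classic.
Local Notation pi := (pi1 R x0).

(** Junk value [1] when [p] is not a loop at [x0]. *)
Definition loop_class p : pi :=
  if pselect (is_loop x0 p) is left h then pg_class (pi1_pregroup R x0) (Loop h)
  else 1%g.

Lemma loop_classE p (h : is_loop x0 p) :
  loop_class p = pg_class (pi1_pregroup R x0) (Loop h).
Proof.
rewrite /loop_class; case: pselect => // h'.
by rewrite (Prop_irrelevance h h').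
Qed.

Lemma is_loop_continuous p :
  continuous p -> p 0 = x0 -> p 1 = x0 -> is_loop x0 p.
Proof. by move=> cp p0 p1; split=> //; exact: continuous_subspaceT. Qed.

Lemma loop_class_homotopic p q : is_loop x0 p -> is_loop x0 q ->
  homotopic x0 p q -> loop_class p = loop_class q.
Proof. by move=> lp lq pq; rewrite !loop_classE; apply/pg_classP. Qed.

Lemma path_homotopic_homotopic p q : p 0 = x0 -> p 1 = x0 ->
  path_homotopic p q -> homotopic x0 p q.
Proof.
move=> p0 p1 [H [cH Hs Ht]]; exists H; split=> //.
  exact: continuous_subspaceT.
by move=> t It; have := Ht _ It; rewrite p0 p1.
Qed.

Lemma homotopic_path_homotopic p q : p 0 = x0 -> p 1 = x0 ->
  homotopic x0 p q -> path_homotopic p q.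
Proof.
move=> p0 p1 [H [cH Hs Ht]].
exists (fun z => H (clamp z.1, clamp z.2)); split.
- by apply: square_continuous => //; [exact: continuous_fst|exact: continuous_snd].
- by move=> s Is /=; rewrite clamp0 clamp1 clamp_id //; exact: Hs.
- by move=> t It /=; rewrite clamp0 clamp1 clamp_id // p0 p1; exact: Ht.
Qed.

Lemma loop_classM p q : is_loop x0 p -> is_loop x0 q ->
  loop_class (concat p q) = (loop_class p * loop_class q)%g.
Proof.
move=> lp lq; rewrite (loop_classE (is_loop_concat lp lq)) !loop_classE.
by rewrite -pg_classM.
Qed.

(** Precomposing with [clamp] turns a loop continuous on the unit interval into one continuous on
    the whole line. *)
Lemma loop_class_surj (a : pi) : exists p,
  [/\ continuous p, p 0 = x0, p 1 = x0 & a = loop_class p].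
Proof.
have lp := loopP (pg_repr a); have [_ p0 p1] := lp.
set p : R -> S := pg_repr a in lp p0 p1.
have cp : continuous (fun s => p (clamp s)).
  by apply: (@loop_continuous _ _ _ _ _ id lp); exact: continuous_idf.
exists (fun s => p (clamp s)); rewrite clamp0 clamp1; split=> //.
have lp' : is_loop x0 (fun s => p (clamp s)).
  by apply: is_loop_continuous; rewrite ?clamp0 ?clamp1.
rewrite (loop_classE lp') -[LHS]pg_reprK; apply/pg_classP.
apply: path_homotopic_homotopic => //.
apply: path_homotopic_sym; apply: path_homotopic_eq => // s Is.
by rewrite /= clamp_id.
Qed.

End LoopClass.

Section Transport.
Local Open Scope ring_scope.
Variables (R : realType) (S : topologicalType) (x0 : S) (g : S -> R -> S).
Hypotheses (g_cont : forall y, continuous (g y)) (g0 : forall y, g y 0 = x0)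
  (g1 : forall y, g y 1 = y).
Implicit Types p q : R -> S.

Definition close_path p : R -> S :=
  concat (concat (g (p 0)) p) (reverse (g (p 1))).

(** This is the retraction of the fundamental groupoid onto its vertex group at [x0] determined by
    the base paths [g]. *)
Definition transport p : pi1 R x0 := loop_class x0 (close_path p).

Lemma is_loop_close p : continuous p -> is_loop x0 (close_path p).
Proof.
move=> cp; apply: is_loop_continuous; rewrite /close_path ?concat0 ?concat1 ?reverse1 //.
apply: continuous_concat; rewrite ?concat1 ?reverse0 ?g1 //.
  by apply: continuous_concat; rewrite ?g1.
exact: continuous_reverse.
Qed.

Lemma transport_homotopic p q : continuous p -> continuous q ->
  path_homotopic p q -> transport p = transport q.
Proof.
move=> cp cq pq; have [e0 e1] := path_homotopic_ends pq.
apply: loop_class_homotopic; [exact: is_loop_close..|].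
apply: path_homotopic_homotopic.
- by rewrite /close_path !concat0 g0.
- by rewrite /close_path concat1 reverse1 g0.
rewrite /close_path -e0 -e1; apply: path_homotopic_concat.
- by rewrite concat1 reverse0 g1.
- by apply: path_homotopic_concat => //; exact: path_homotopic_refl.
- by apply: path_homotopic_refl; exact: continuous_reverse.
Qed.

Lemma transport_concat p q : continuous p -> continuous q -> p 1 = q 0 ->
  transport (concat p q) = (transport p * transport q)%g.
Proof.
move=> cp cq pq.
rewrite /transport -loop_classM; [|exact: is_loop_close..].
have cpq := continuous_concat cp cq pq.
apply: loop_class_homotopic; first exact: is_loop_close.
  by apply: is_loop_concat; exact: is_loop_close.
apply: path_homotopic_homotopic.
- by rewrite /close_path !concat0 g0.
- by rewrite /close_path concat1 reverse1 g0.
rewrite /close_path concat0 concat1 -pq.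
set a := g (p 0); set w := g (p 1); set b := reverse (g (q 1)).
have ca : continuous a by exact: g_cont.
have cw : continuous w by exact: g_cont.
have cb : continuous b by apply: continuous_reverse.
have cV : continuous (reverse w) by apply: continuous_reverse.
have a1 : a 1 = p 0 by rewrite /a g1.
have w1 : w 1 = q 0 by rewrite /w g1.
have b0 : b 0 = q 1 by rewrite /b reverse0 g1.
have cap : continuous (concat a p) by apply: continuous_concat.
have cqb : continuous (concat q b) by apply: continuous_concat.
have cwq : continuous (concat w q) by apply: continuous_concat.
have cwqb : continuous (concat (concat w q) b).
  by apply: continuous_concat; rewrite ?concat1.
have cap1 : concat a p 1 = reverse w 0 by rewrite concat1 reverse0 w1.
have cV1 : reverse w 1 = concat (concat w q) b 0.
  by rewrite reverse1 !concat0.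
(* The detour from [p 1] to [x0] and back, created by closing both paths, cancels. *)
have tail : path_homotopic (concat (reverse w) (concat (concat w q) b)) (concat q b).
  apply: path_homotopic_trans (path_homotopic_concat1 cqb (concat0 q b)).
  apply: (@path_homotopic_trans _ _ _ (concat (concat (reverse w) w) (concat q b))).
    apply: (@path_homotopic_trans _ _ _ (concat (reverse w) (concat w (concat q b)))).
      apply: path_homotopic_concat => //; first exact: path_homotopic_refl.
      by apply: path_homotopic_sym; exact: path_homotopic_concatA.
    by apply: path_homotopic_concatA => //; rewrite ?reverse1 ?concat0.
  apply: path_homotopic_concat; rewrite ?concat1 ?concat0 //.
    by rewrite -w1; exact: path_homotopic_concatVx.
  exact: path_homotopic_refl.
apply: path_homotopic_sym.
apply: (@path_homotopic_trans _ _ _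
  (concat (concat a p) (concat (reverse w) (concat (concat w q) b)))).
  by apply: path_homotopic_sym; exact: path_homotopic_concatA.
apply: (@path_homotopic_trans _ _ _ (concat (concat a p) (concat q b))).
  apply: path_homotopic_concat tail; first by rewrite concat0.
  exact: path_homotopic_refl.
apply: (@path_homotopic_trans _ _ _ (concat (concat (concat a p) q) b)).
  by apply: path_homotopic_concatA; rewrite ?concat1.
apply: path_homotopic_concat; first by rewrite !concat1.
  by apply: path_homotopic_sym; exact: path_homotopic_concatA.
exact: path_homotopic_refl.
Qed.

Lemma transport_loop p : continuous p -> p 0 = x0 -> p 1 = x0 ->
  g x0 = (fun=> x0) -> transport p = loop_class x0 p.
Proof.
move=> cp p0 p1 gx0.
have lp : is_loop x0 p by exact: is_loop_continuous.
have l1 : is_loop x0 (fun _ : R => x0) by exact: is_loop_cst.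
have c1 : loop_class x0 (fun _ : R => x0) = 1%g.
  by rewrite (loop_classE (@is_loop_cst R S x0)).
have lr : is_loop x0 (reverse (fun _ : R => x0)) by exact: l1.
rewrite /transport /close_path p0 p1 gx0 !loop_classM //; last exact: is_loop_concat.
by rewrite [reverse _](_ : _ = fun _ : R => x0) // c1 mulg1 mul1g.
Qed.

End Transport.

(** * Finite coverings *)

Section Covering.
Local Open Scope ring_scope.
Variables (R : realType) (S : topologicalType) (Q : groupType) (m : (R -> S) -> Q).
Implicit Types (p q : R -> S) (U : set S).
Local Notation I01 := `[0, 1]%classic.

(** The covering space with fibre [Q] and monodromy [m]: moving along a path
    [p] of [S] multiplies the fibre coordinate by [m p]. *)
Definition covering of (R -> S) -> Q : Type := (S * Q)%type.

HB.instance Definition _ := gen_eqMixin (covering m).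
HB.instance Definition _ := gen_choiceMixin (covering m).

(** Openness is tested by lifting short paths, which makes the axioms of a topology immediate,
    before anything is known about [m]. *)
Definition covering_open (O : set (covering m)) :=
  forall x, O x -> exists U, [/\ open U, U x.1 &
    forall p, continuous p -> (forall s, U (p s)) -> p 0 = x.1 ->
      O (p 1, (x.2 * m p)%g)].

Fact covering_openT : covering_open setT.
Proof. by move=> x _; exists setT; split=> //; exact: openT. Qed.

Fact covering_openI : setI_closed covering_open.
Proof.
move=> A B oA oB x [/oA[U [oU Ux hU]] /oB[W [oW Wx hW]]].
exists (U `&` W); split=> [|//|p cp UW p0]; first exact: openI.
by split; [apply: hU|apply: hW] => // s; have [] := UW s.
Qed.

Fact covering_open_bigU (I : Type) (f : I -> set (covering m)) :
  (forall i, covering_open (f i)) -> covering_open (\bigcup_i f i).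
Proof.
move=> fO x [i _ /fO[U [oU Ux hU]]]; exists U; split=> // p cp Up p0.
by exists i => //; exact: hU.
Qed.

HB.instance Definition _ := isOpenTopological.Build (covering m)
  covering_openT covering_openI covering_open_bigU.

Lemma covering_openE (O : set (covering m)) : open O = covering_open O.
Proof. by []. Qed.

Hypothesis m_homotopic : forall p q, continuous p -> continuous q ->
  path_homotopic p q -> m p = m q.
Hypothesis m_concat : forall p q, continuous p -> continuous q -> p 1 = q 0 ->
  m (concat p q) = (m p * m q)%g.

Lemma m_cst y : m (fun=> y) = 1%g.
Proof.
have cy : continuous (fun _ : R => y) by exact: continuous_cstf.
apply: (mulgI (m (fun=> y))); rewrite mulg1 -m_concat //.
apply: m_homotopic => //; first exact: continuous_concat.
exact: path_homotopic_concat1.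
Qed.

Definition covering_proj (x : covering m) : S := x.1.

Lemma continuous_covering_proj : continuous covering_proj.
Proof.
apply/continuousP => U oU; rewrite covering_openE => x Ux.
by exists U; split=> // p cp Up p0; exact: Up.
Qed.

(** Over a disc [U] containing [x.1] this is the copy of [U] through [x]. *)
Definition sheet U (x : covering m) : set (covering m) :=
  [set z | exists p : R -> S,
  [/\ continuous p, forall s, U (p s), p 0 = x.1 & z = (p 1, (x.2 * m p)%g)]].

Lemma open_sheet U x : open U -> open (sheet U x).
Proof.
move=> oU; rewrite covering_openE => _ [p [cp Up p0 ->]].
exists U; split=> //= q cq Uq q0.
exists (concat p q); split.
- by apply: continuous_concat.
- exact: concat_in.
- by rewrite concat0.
- by rewrite concat1 m_concat // mulgA.
Qed.

Lemma sheet_refl U x : U x.1 -> sheet U x x.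
Proof.
move=> Ux; exists (fun=> x.1); split=> //; first exact: continuous_cstf.
by rewrite m_cst mulg1; case: x Ux.
Qed.

Lemma sheet_sub U x : sheet U x `<=` covering_proj @^-1` U.
Proof. by move=> _ [p [_ Up _ ->]]; exact: Up. Qed.

(** In a disc the monodromy of a path depends only on its end points. *)
Lemma sheet_inj U x : disc R U -> set_inj (sheet U x) covering_proj.
Proof.
move=> [_ _ Uh] _ _ /set_mem[p [cp Up p0 ->]] /set_mem[q [cq Uq q0 ->]] /= pq.
rewrite /covering_proj /= in pq.
rewrite pq (_ : m p = m q) //; apply: m_homotopic => //; apply: Uh => //.
by rewrite q0.
Qed.

Lemma sheet_disjoint U y (a b : Q) : disc R U -> a <> b ->
  sheet U (y, a) `&` sheet U (y, b) = set0.
Proof.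
move=> [_ _ Uh] ab; apply/eqP/negPn/negP => /set0P[_ [[p [cp Up p0 ->]]]].
move=> [q [cq Uq q0 [pq]]].
rewrite (_ : m q = m p); first by move=> /mulIg.
apply: m_homotopic => //; apply: Uh => //.
by rewrite q0.
Qed.

Lemma sheet_cover U y x : disc R U -> U y -> U x.1 -> exists a, sheet U (y, a) x.
Proof.
move=> dU Uy Ux; have [p [cp pU p0 p1]] : exists p, [/\ continuous p,
    forall s, U (p s), p 0 = y & p 1 = x.1].
  by have [_ + _] := dU; apply.
exists (x.2 * (m p)^-1)%g, p; split=> //=.
by rewrite mulgVK p1; case: x {Ux p1}.
Qed.

Section LocallyDisc.
Hypothesis dS : locally_disc R S.

Lemma covering_proj_open (O : set (covering m)) : open O -> open (covering_proj @` O).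
Proof.
rewrite covering_openE openE => oO _ [x Ox <-].
have [U [oU Ux hU]] := oO _ Ox.
have [D [oD Dp _] [Dx DU]] := dS (open_nbhs_nbhs (conj oU Ux)).
have : nbhs (covering_proj x) D by exact: open_nbhs_nbhs.
apply: filterS => y Dy; have [p [cp pD p0 p1]] := Dp _ _ Dx Dy.
exists (p 1, (x.2 * m p)%g) => //.
by apply: hU => // s; exact: DU.
Qed.

Lemma covering_hausdorff : hausdorff_space S -> hausdorff_space (covering m).
Proof.
rewrite !open_hausdorff => hS x y xy.
have [exy|nxy] := eqVneq x.1 y.1.
  have [U dU [Ux _]] := dS (filterT : nbhs x.1 setT).
  have [oU _ _] := dU.
  exists (sheet U x, sheet U y).
    by rewrite !inE; split; apply: sheet_refl; rewrite -?exy.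
  split; [exact: open_sheet..|].
  apply/eqP; case: x y xy exy {Ux} => [z a] [w b] /= zab zw; subst w.
  by apply: sheet_disjoint => // ab; rewrite ab eqxx in zab.
have [[A B] /= [Ax By] [oA oB AB]] := hS _ _ nxy.
exists (covering_proj @^-1` A, covering_proj @^-1` B) => /=.
  by rewrite !inE /= in Ax By *.
split; [by move/continuousP: continuous_covering_proj; apply..|].
by rewrite -preimage_setI (eqP AB) preimage_set0.
Qed.

(** The projection of an ultrafilter converges to some [y]. Finitely many sheets cover the part over
    a disc around [y], so one of them belongs to the ultrafilter and determines the limit. *)
Lemma covering_compact : finite_group Q -> compact [set: S] ->
  compact [set: covering m].
Proof.
rewrite !compact_ultra => finQ cS F UF FT.
have UG : UltraFilter (covering_proj @ F).
  apply: Build_UltraFilter => G PG FG; apply/seteqP; split=> // A GA.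
  have [//|FnA] := in_ultra_setVsetC (covering_proj @^-1` A) UF.
  have /FG GnA : (covering_proj @ F) (~` A) by [].
  by have /filter_ex[? []] : G (A `&` ~` A) by exact: filterI.
have [y [_ Fy]] := cS _ UG (filterT : (covering_proj @ F) setT).
have [U dU [Uy _]] := dS (filterT : nbhs y setT).
have [oU _ _] := dU.
have FU : F (covering_proj @^-1` U) by apply: Fy; exact: open_nbhs_nbhs.
have [a Fa] : exists a, F (sheet U (y, a)).
  apply: contrapT => /forallNP nF.
  move/finite_seqP: finQ => [s sE].
  have Fs : F [set x | forall a, a \in s -> ~ sheet U (y, a) x].
    elim: (s) => [|a t IH]; first by apply: filterS filterT.
    have [/nF//|Fa] := in_ultra_setVsetC (sheet U (y, a)) UF.
    apply: filterS (filterI Fa IH) => x [nax tx] b.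
    by rewrite inE => /orP[/eqP ->//|]; exact: tx.
  apply: (@filter_not_empty _ F).
  apply: filterS (filterI FU Fs) => x [Ux sx].
  have [a xa] := sheet_cover dU Uy Ux.
  apply: sx xa; suff : [set: Q] a by rewrite sE.
  by [].
exists (y, a); split=> // N nN.
have [B [oB By BN]] : exists B : set (covering m),
    [/\ open B, B (y, a) & B `<=` N].
  by move: nN; rewrite nbhsE => -[B [oB By] BN]; exists B.
(* The projection of [B] within the sheet is a neighbourhood of [y]; injectivity on the sheet then
   leads back into [B]. *)
have FOU : F (covering_proj @^-1` (covering_proj @` (B `&` sheet U (y, a)))).
  apply: Fy; apply: open_nbhs_nbhs; split.
    by apply: covering_proj_open; apply: openI => //; exact: open_sheet.
  by exists (y, a) => //; split=> //; exact: sheet_refl.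
apply: filterS (filterI Fa FOU) => x [ax [z [Bz az] zx]].
by apply: BN; rewrite -(sheet_inj dU (mem_set az) (mem_set ax) zx).
Qed.

(** The lift follows straight segments issued from [0], so that no
    subdivision of the square is needed. *)
Definition lift (a : Q) (h : R * R -> S) (z : R * R) : covering m :=
  (h z, (a * m (fun s => h (convex_comb (0, 0) z s)))%g).

(** The segment from [0] to a nearby [w] is homotopic, across a triangle, to the segment to [z]
    followed by a short one from [z] to [w], whose image stays in [U]. *)
Lemma continuous_lift a h : continuous h -> continuous (lift a h).
Proof.
move=> ch; apply/continuousP => O oO; rewrite openE => z Oz.
have [U [oU Uz hU]] := oO _ Oz.
have : nbhs z (h @^-1` U) by apply: ch; exact: open_nbhs_nbhs.
move=> /nbhs_ballP[e /= e0 eU].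
apply/nbhs_ballP; exists e => // w zw /=.
have cseg u v : continuous (fun s : R => convex_comb u v s).
  apply: continuous_convex_comb; [exact: continuous_cstf..|exact: continuous_idf].
pose p s := h (convex_comb (0, 0) z s).
pose q s := h (convex_comb z w (clamp s)).
have cp : continuous p by exact: (continuous_compf (cseg _ _) ch).
have cq : continuous q.
  apply: (continuous_compf _ ch).
  by apply: (continuous_compf _ (cseg _ _)); exact: continuous_clamp.
have p1 : p 1 = h z by rewrite /p convex_comb1.
have q0 : q 0 = h z by rewrite /q clamp0 convex_comb0.
have q1 : q 1 = h w by rewrite /q clamp1 convex_comb1.
have pq : p 1 = q 0 by rewrite p1.
rewrite /lift -q1 (_ : m _ = (m p * m q)%g).
  rewrite mulgA; apply: hU => // s; apply: eU.
  by apply: convex2_ball => //; [exact: ballxx|exact: clamp_itv].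
rewrite -m_concat //; apply: m_homotopic.
- exact: (continuous_compf (cseg _ _) ch).
- exact: continuous_concat.
apply: (@path_homotopic_convex _ _ setT h (fun s => convex_comb (0, 0) w s)
  (concat (fun s => convex_comb (0, 0) z s) (fun s => convex_comb z w (clamp s)))) => //.
- exact: continuous_subspaceT.
- apply: continuous_concat => //; last by rewrite clamp0 convex_comb1 convex_comb0.
  by apply: (continuous_compf _ (cseg _ _)); exact: continuous_clamp.
- by rewrite concat0 !convex_comb0.
- by rewrite concat1 clamp1 !convex_comb1.
- by move=> s _; rewrite /concat /p /q; case: ifP.
Qed.

(** Agreement is locally constant: over a disc, two sheets through points of one fibre are equal or
    disjoint. *)
Lemma covering_unique (f g : R -> covering m) :
  continuous f -> continuous g -> (forall t, (f t).1 = (g t).1) ->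
  f 0 = g 0 -> f = g.
Proof.
move=> cf cg fg fg0; apply/funext => t.
apply: (@connected_locally_constant R [set t | f t = g t]
  (@connected_real R) _ 0 t) => //.
move=> {}t /=.
have [U dU [Ut _]] := dS (filterT : nbhs (f t).1 setT).
have [oU _ _] := dU.
have near_sheet (h : R -> covering m) : continuous h -> (h t).1 = (f t).1 ->
    \forall s \near t, sheet U (h t) (h s).
  move=> ch hf; apply: (ch t); apply: open_nbhs_nbhs; split.
    exact: open_sheet.
  by apply: sheet_refl; rewrite hf.
have Nf := near_sheet f cf erefl; have Ng := near_sheet g cg (esym (fg t)).
near=> s; have fs : sheet U (f t) (f s) by near: s.
have gs : sheet U (g t) (g s) by near: s.
split=> [e|e].
  rewrite -e in gs.
  by apply: (sheet_inj dU (mem_set fs) (mem_set gs)); exact: fg.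
have [ab|nab] := pselect ((f t).2 = (g t).2).
  by rewrite [LHS]surjective_pairing [RHS]surjective_pairing fg ab.
have := sheet_disjoint (f t).1 dU nab.
rewrite -surjective_pairing fg -surjective_pairing => /seteqP[+ _].
by move=> /(_ (f s)); case; split=> //; rewrite e.
Unshelve. all: by end_near. Qed.

End LocallyDisc.

Section CoveringSurface.
Hypothesis dS : locally_disc R S.

Definition path_lift (a : Q) p (t : R) : covering m := lift a (fun z => p z.1) (t, 0).

Lemma continuous_path_lift a p : continuous p -> continuous (path_lift a p).
Proof.
move=> cp.
have cl : continuous (lift a (fun z => p z.1)).
  by apply: continuous_lift; exact: (continuous_compf (@continuous_fst R) cp).
apply: (continuous_compf _ cl); apply: continuous_pairf.
  exact: continuous_idf.
exact: continuous_cstf.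
Qed.

Lemma lift0 a h : lift a h (0, 0) = (h (0, 0), a).
Proof.
rewrite /lift (_ : (fun s => _) = fun=> h (0, 0)); first by rewrite m_cst mulg1.
by apply/funext => s; rewrite convex_combxx.
Qed.

Lemma path_lift0 a p : path_lift a p 0 = (p 0, a).
Proof. exact: lift0. Qed.

Lemma path_lift1 a p : path_lift a p 1 = (p 1, (a * m p)%g).
Proof.
congr (_, (_ * m _)%g); apply/funext => s.
by rewrite /convex_comb /= mulr0 add0r mulr1.
Qed.

(** Every point is the end of the lift, from [(x0, 1)], of some path in [S]. *)
Lemma covering_connected x0 :
  (forall y a, exists p, [/\ continuous p, p 0 = x0, p 1 = y & m p = a]) ->
  connected [set: covering m].
Proof.
move=> mS.
have -> : [set: covering m] = \bigcup_(p in [set p | continuous p /\ p 0 = x0])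
    range (path_lift 1%g p).
  apply/seteqP; split=> // -[y a] _; have [p [cp p0 p1 mp]] := mS y a.
  by exists p => //; exists 1 => //; rewrite path_lift1 p1 mp mul1g.
apply: bigcup_connected => [|p [cp _]].
  by exists (x0, 1%g) => p [cp p0]; exists 0 => //; rewrite path_lift0 p0.
apply: connected_continuous_connected; first exact: connected_real.
apply: continuous_subspaceT; exact: continuous_path_lift.
Qed.

Definition sheet_chart (c : chart R S) U x :=
  Chart (sheet U x) (fun z => chart_map c (covering_proj z)).

Lemma hyp_sheet_chart c U x : is_hyp_chart c -> disc R U -> U `<=` chart_dom c ->
  is_hyp_chart (sheet_chart c U x).
Proof.
move=> [oD cH cc cI cO] dU UD; have [oU _ _] := dU.
have sD z : sheet U x z -> chart_dom c (covering_proj z).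
  by move=> /sheet_sub; exact: UD.
split=> /=.
- exact: open_sheet.
- by move=> _ [z /sD Dz <-]; apply: cH; exists (covering_proj z).
- apply: continuous_in_subspaceT => z /set_mem/sD Dz.
  apply: continuous_comp; first exact: continuous_covering_proj.
  exact: (continuous_within_open oD cc).
- move=> y z ys zs e; apply: (sheet_inj dU ys zs).
  by apply: cI e; apply/mem_set/sD/set_mem.
- move=> O oO Os.
  rewrite (_ : [set _ | _ in _] = chart_map c @` (covering_proj @` O)).
    apply: cO; first exact: covering_proj_open.
    by move=> _ [z /Os/sD ? <-].
  by rewrite -image_comp.
Qed.

(** The charts are those of [S] read through the projection, so local isometry is inherited. *)
Lemma covering_hyperbolic A : hyperbolic_atlas A ->
  hyperbolic_atlas [set c' | exists c U x,
    [/\ A c, disc R U, U `<=` chart_dom c & c' = sheet_chart c U x]].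
Proof.
move=> [hA covA isoA]; split.
- by move=> _ [c [U [x [/hA hc dU UD ->]]]]; exact: hyp_sheet_chart.
- move=> x; have [c Ac cx] := covA x.1.
  have [oD _ _ _ _] := hA _ Ac.
  have [U dU [Ux UD]] := dS (open_nbhs_nbhs (conj oD cx)).
  exists (sheet_chart c U x); first by exists c, U, x.
  exact: sheet_refl.
move=> _ _ [c [U [x [Ac dU UD ->]]]] [c' [U' [x' [Ac' dU' UD' ->]]]] z /= sz sz'.
have [|W nW [WD Wiso]] := isoA _ _ Ac Ac' z.1 (UD _ (sheet_sub sz)).
  by apply: UD'; exact: (sheet_sub sz').
have [[oU _ _] [oU' _ _]] := (dU, dU').
exists (sheet U x `&` sheet U' x' `&` covering_proj @^-1` W).
  apply: filterI; last exact: (continuous_covering_proj nW).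
  by apply: open_nbhs_nbhs; split; first by apply: openI; exact: open_sheet.
by split=> [y [? _]//|y w [_ Wy] [_ Ww]]; exact: Wiso.
Qed.

Lemma covering_surface x0 : finite_group Q ->
  (forall y a, exists p, [/\ continuous p, p 0 = x0, p 1 = y & m p = a]) ->
  closed_hyperbolic_surface R S -> closed_hyperbolic_surface R (covering m).
Proof.
move=> finQ mS [_ _ kS hS [A hA]]; split.
- by exists (x0, 1%g).
- exact: covering_connected mS.
- exact: covering_compact.
- exact: covering_hausdorff.
- by eexists; exact: covering_hyperbolic hA.
Qed.

(** The homotopy is lifted on the whole square, and uniqueness of lifts identifies its four sides,
    each starting from a corner already known. *)
Lemma covering_path_homotopic (p q : R -> covering m) :
  continuous p -> continuous q -> p 0 = q 0 -> p 1 = p 0 -> (p 0).2 = 1%g ->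
  path_homotopic (fun s => covering_proj (p s)) (fun s => covering_proj (q s)) ->
  path_homotopic p q.
Proof.
move=> cp cq pq0 p10 p02 [H [cH Hs Ht]].
have cL : continuous (lift 1%g H) by exact: continuous_lift.
have edge (u v : R -> R) (r : R -> covering m) : continuous u -> continuous v ->
    continuous r -> (forall s, H (u s, v s) = covering_proj (r s)) ->
    lift 1%g H (u 0, v 0) = r 0 -> forall s, lift 1%g H (u s, v s) = r s.
  move=> cu cv cr Hr r0 s.
  have -> // : r = (fun s => lift 1%g H (u s, v s)).
  apply/esym/(covering_unique dS) => //.
  by apply: (continuous_compf _ cL); exact: continuous_pairf.
(* The sides of [H] are prescribed only on the unit interval, while uniqueness of lifts concerns the
   whole line. *)
have ccl (r : R -> covering m) : continuous r -> continuous (fun s => r (clamp s)).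
  by move=> cr; exact: (continuous_compf (@continuous_clamp R) cr).
have bottom s : lift 1%g H (clamp s, 0) = p (clamp s).
  apply: (edge (@clamp R) (fun=> 0) (fun s => p (clamp s))).
  - exact: continuous_clamp.
  - exact: continuous_cstf.
  - exact: ccl.
  - by move=> t; exact: (Hs _ (clamp_itv t)).1.
  - by rewrite clamp0 lift0 (Hs 0 (I0 R)).1 -p02 -surjective_pairing.
have left t : lift 1%g H (0, clamp t) = p 0.
  apply: (edge (fun=> 0) (@clamp R) (fun=> p 0)).
  - exact: continuous_cstf.
  - exact: continuous_clamp.
  - exact: continuous_cstf.
  - by move=> s; exact: (Ht _ (clamp_itv s)).1.
  - by rewrite clamp0; have := bottom 0; rewrite clamp0.
have top s : lift 1%g H (clamp s, 1) = q (clamp s).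
  apply: (edge (@clamp R) (fun=> 1) (fun s => q (clamp s))).
  - exact: continuous_clamp.
  - exact: continuous_cstf.
  - exact: ccl.
  - by move=> t; exact: (Hs _ (clamp_itv t)).2.
  - by rewrite clamp0 -pq0; have := left 1; rewrite clamp1.
have right t : lift 1%g H (1, clamp t) = p 1.
  apply: (edge (fun=> 1) (@clamp R) (fun=> p 1)).
  - exact: continuous_cstf.
  - exact: continuous_clamp.
  - exact: continuous_cstf.
  - by move=> s; exact: (Ht _ (clamp_itv s)).2.
  - by rewrite clamp0; have := bottom 1; rewrite clamp1.
exists (lift 1%g H); split=> // t It.
- by have := bottom t; have := top t; rewrite clamp_id.
- by have := left t; have := right t; rewrite clamp_id.
Qed.

(** The loop is the lift of its own projection, and the fibre coordinate at the end of that lift is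
    the monodromy. *)
Lemma covering_loop_monodromy (p : R -> covering m) : continuous p ->
  p 0 = p 1 -> (p 0).2 = 1%g -> m (fun s => covering_proj (p s)) = 1%g.
Proof.
move=> cp p01 p02.
have cpp : continuous (fun s => covering_proj (p s)).
  exact: (continuous_compf cp continuous_covering_proj).
have pE : p = path_lift 1%g (fun s => covering_proj (p s)).
  apply: (covering_unique dS) => //; first exact: continuous_path_lift.
  by rewrite path_lift0 -p02 -surjective_pairing.
have := congr1 (fun r => (r 1).2) pE.
by rewrite path_lift1 /= mul1g -p01 p02.
Qed.

End CoveringSurface.
End Covering.

(** * Induced maps and finite-index subgroups *)

Section Functoriality.
Local Open Scope ring_scope.
Variables (R : realType) (S T : topologicalType) (h : S -> T) (x0 : S).
Hypothesis ch : continuous h.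

Definition pi1_map (a : pi1 R x0) : pi1 R (h x0) :=
  loop_class (h x0) (fun s => h (pg_repr a s)).

Lemma is_loop_map p : is_loop x0 p -> is_loop (h x0) (fun s : R => h (p s)).
Proof.
move=> [cp p0 p1]; split; rewrite ?p0 ?p1 //.
exact: (@continuous_compf (subspace (`[0, 1]%classic : set R)) S T p h cp ch).
Qed.

Lemma homotopic_map (p q : R -> S) : homotopic x0 p q ->
  homotopic (h x0) (fun s => h (p s)) (fun s => h (q s)).
Proof.
move=> [H [cH Hs Ht]]; exists (fun z => h (H z)); split.
- exact: (@continuous_compf (subspace
    ((`[0, 1] `*` `[0, 1])%classic : set (R * R))) S T H h cH ch).
- by move=> s Is; have [-> ->] := Hs s Is.
- by move=> t It; have [-> ->] := Ht t It.
Qed.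

Lemma pi1_map_class p : is_loop x0 p ->
  pi1_map (loop_class x0 p) = loop_class (h x0) (fun s : R => h (p s)).
Proof.
move=> lp; apply: loop_class_homotopic; try exact: is_loop_map.
- by apply: is_loop_map; exact: loopP.
- apply: homotopic_map; rewrite (loop_classE lp).
  exact: (pg_classK (pi1_pregroup R x0) (Loop lp)).
Qed.

Lemma pi1_mapM : {morph pi1_map : a b / (a * b)%g}.
Proof.
move=> a b; have [p [cp p0 p1 ->]] := loop_class_surj a.
have [q [cq q0 q1 ->]] := loop_class_surj b.
have lp : is_loop x0 p by exact: is_loop_continuous.
have lq : is_loop x0 q by exact: is_loop_continuous.
rewrite -loop_classM // !pi1_map_class //; last exact: is_loop_concat.
rewrite -loop_classM; [|exact: is_loop_map..].
congr loop_class; apply/funext => s.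
by rewrite /concat; case: ifP.
Qed.

End Functoriality.

(** In the covering with monodromy [transport] modulo [N], loops project to classes in [N], and the
    projection is injective on classes by homotopy lifting. *)
Lemma surface_group_finite_index (R : realType) (S : topologicalType) (x0 : S)
    (N : set (pi1 R x0)) (nN : is_normal N) :
  closed_hyperbolic_surface R S -> finite_group (quotient_group nN) ->
  exists (S' : topologicalType) (y0 : S') (f : pi1 R y0 -> pi1 R x0),
    [/\ closed_hyperbolic_surface R S', {morph f : x y / (x * y)%g}, injective f &
        forall p, N (f p)].
Proof.
move=> hS finQ; set Q := quotient_group nN in finQ.
have [_ cS _ _ _] := hS; have dS := hyperbolic_locally_disc hS.
have [g [cg g0 g1 gx0]] := base_paths x0 cS dS.
pose c : pi1 R x0 -> Q := @pg_class _ (quotient_pregroup nN).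
have cM : {morph c : a b / (a * b)%g} by move=> a b; exact: pg_classM.
pose m (p : R -> S) : Q := c (transport x0 g p).
have mH (p q : R -> S) : continuous p -> continuous q ->
    path_homotopic p q -> m p = m q.
  by move=> cp cq pq; congr c; exact: transport_homotopic.
have mC (p q : R -> S) : continuous p -> continuous q -> p 1%R = q 0%R ->
    m (concat p q) = (m p * m q)%g.
  by move=> cp cq pq; rewrite -cM; congr c; exact: transport_concat.
have mS y a : exists p : R -> S, [/\ continuous p, p 0%R = x0, p 1%R = y & m p = a].
  have [l [cl l0 l1 la]] := loop_class_surj (pg_repr (a * (m (g y))^-1)%g).
  (* The loop [l] corrects the monodromy of [g y] to the prescribed value [a]. *)
  exists (concat l (g y)); rewrite concat0 concat1; split=> //.
    by apply: continuous_concat => //; rewrite l1.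
  rewrite mC ?l1 // {1}/m (transport_loop cl l0 l1 gx0) -la /c pg_reprK.
  exact: mulgVK.
pose S' := covering m; pose y0 : S' := (x0, 1%g).
have cproj := @continuous_covering_proj R S Q m.
exists S', y0, (@pi1_map R S' S (@covering_proj R S Q m) y0); split.
- exact: (covering_surface mH mC dS finQ mS).
- exact: pi1_mapM.
- move=> a b; have [p [cp p0 p1 ->]] := loop_class_surj a.
  have [q [cq q0 q1 ->]] := loop_class_surj b.
  have lp : is_loop y0 p by exact: is_loop_continuous.
  have lq : is_loop y0 q by exact: is_loop_continuous.
  rewrite !pi1_map_class //.
  rewrite (loop_classE (is_loop_map cproj lp)) (loop_classE (is_loop_map cproj lq)).
  move=> /pg_classP pq; apply: loop_class_homotopic => //.
  apply: path_homotopic_homotopic => //.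
  apply: (covering_path_homotopic mH mC dS) => //; rewrite ?p0 ?p1 ?q0 //.
  by apply: homotopic_path_homotopic pq; rewrite /= ?p0 ?p1.
move=> a; have [p [cp p0 p1 ->]] := loop_class_surj a.
have lp : is_loop y0 p by exact: is_loop_continuous.
rewrite pi1_map_class //.
have : m (fun s => covering_proj (p s)) = 1%g.
  by apply: (covering_loop_monodromy mH mC dS) => //; rewrite p0 ?p1.
rewrite /m transport_loop //; last first.
- by rewrite p1.
- by rewrite p0.
- exact: (continuous_compf cp cproj).
move=> /pg_classP /=; rewrite mulg1.
by have [[_ _ NV] _] := nN => /NV; rewrite invgK.
Qed.

(** * Finite generation *)

Section FiniteGeneration.
Local Open Scope ring_scope.

Lemma filter_forall_seq (T : Type) (I : eqType) (F : set_system T) {FF : Filter F}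
    (s : seq I) (P : I -> set T) :
  (forall i, i \in s -> F (P i)) -> F [set z | forall i, i \in s -> P i z].
Proof.
elim: s => [|j s IH] sP; first by apply: filterS filterT.
have Fs : F [set z | forall i, i \in s -> P i z].
  by apply: IH => i si; apply: sP; rewrite inE si orbT.
apply: filterS (filterI (sP j (mem_head j s)) Fs) => z [Pj Ps] i.
by rewrite inE => /orP[/eqP ->//|]; exact: Ps.
Qed.

Lemma compact_finite_cover (X : topologicalType) (K : set X) (f : X -> set X) :
  compact K -> (forall x, K x -> nbhs x (f x)) ->
  exists s : seq X, forall y, K y -> exists2 x, x \in s & f x y.
Proof.
move=> /compact_near_coveringP cK Kf.
(* The finite lists, directed by inclusion. *)
pose F : set_system (seq X) :=
  [set A | exists s : seq X, forall t : seq X, {subset s <= t} -> A t].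
have FF : Filter F.
  split; first by exists [::].
    move=> A B [s sA] [t tB]; exists (s ++ t) => u stu; split.
      by apply: sA => x xs; apply: stu; rewrite mem_cat xs.
    by apply: tB => x xt; apply: stu; rewrite mem_cat xt orbT.
  by move=> A B AB [s sA]; exists s => t /sA; exact: AB.
have [x Kx|s sK] := cK _ F (fun s y => exists2 x, x \in s & f x y) FF.
  exists (f x, [set s | x \in s]) => /=; last by move=> [y s] /= [fy xs]; exists x.
  split; first exact: Kf.
  by exists [:: x] => t; apply; rewrite mem_head.
by exists s => y /(sK s (fun=> id)).
Qed.

Lemma compact_locally_constant (X : topologicalType) (T : eqType) (K : set X)
    (G : X -> T) :
  compact K -> (forall y, K y -> \forall z \near y, G z = G y) ->
  finite_set (G @` K).
Proof.
move=> cK Gl.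
have [s sK] := compact_finite_cover cK Gl.
apply: (@sub_finite_set _ _ (G @` [set` s])); last exact: finite_image.
by move=> _ [y /sK[x xs ->] <-]; exists x.
Qed.

Variables (R : realType) (S : topologicalType) (x0 : S).

(** Finitely many closed [K x] inside discs [U x] cover [S]. Changing from one disc to another along
    a loop costs a factor [G x x' y]; these factors are locally constant in [y], hence finitely many
    by compactness. *)
Lemma surface_group_fg : closed_hyperbolic_surface R S ->
  exists s : seq (pi1 R x0), generated [set` s] = [set: pi1 R x0].
Proof.
move=> hS; have [_ cS kS hausS _] := hS; have dS := hyperbolic_locally_disc hS.
have [g [cg g0 g1 gx0]] := base_paths x0 cS dS.
pose m := transport (R := R) x0 g.
have mH (p q : R -> S) : continuous p -> continuous q ->
    path_homotopic p q -> m p = m q.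
  exact: transport_homotopic.
have mC (p q : R -> S) : continuous p -> continuous q -> p 1 = q 0 ->
    m (concat p q) = (m p * m q)%g.
  exact: transport_concat.
have /choice[U UP] : forall x : S, exists U : set S, disc R U /\ U x.
  by move=> x; have [U dU [Ux _]] := dS x _ filterT; exists U.
have /choice[K KP] : forall x : S, exists K : set S, [/\ closed K, nbhs x K & K `<=` U x].
  move=> x; have [[oU _ _] Ux] := UP x.
  have nU : nbhs x (U x) by exact: open_nbhs_nbhs.
  have [B nB BU] := compact_regular (x := x) hausS kS filterT nU.
  exists (closure B); split=> //; first exact: closed_closure.
  by apply: filterS nB; exact: subset_closure.
(* [a (x, y)] is the common value of [m] on paths from [x] to [y] inside [U x], and junk if [y] is
   not in [U x]. *)
have /choice[a aP] : forall xy : S * S, exists c, forall u : R -> S,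
    continuous u -> (forall s, U xy.1 (u s)) -> u 0 = xy.1 -> u 1 = xy.2 -> m u = c.
  move=> [x y] /=; have [[_ Up Uh] Ux] := UP x.
  have [Uy|nUy] := pselect (U x y); last first.
    by exists 1%g => u _ Uu _ u1; case: nUy; rewrite -u1.
  have [p [cp pU p0 p1]] := Up _ _ Ux Uy.
  exists (m p) => u cu Uu u0 u1; apply: mH => //.
  by apply: Uh; rewrite ?u0 ?u1.
have a_step x y z (v : R -> S) : U x y -> continuous v -> (forall s, U x (v s)) ->
    v 0 = y -> v 1 = z -> a (x, z) = (a (x, y) * m v)%g.
  move=> Uy cv Uv v0 v1; have [[_ Up _] Ux] := UP x.
  have [u [cu Uu u0 u1]] := Up _ _ Ux Uy.
  have cuv : continuous (concat u v) by apply: continuous_concat; rewrite ?u1.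
  rewrite -(aP (x, y) u) //= -(aP (x, z) (concat u v)) ?concat0 ?concat1 //=.
    by rewrite mC // u1.
  exact: concat_in.
pose G x x' y := (a (x, y) * (a (x', y))^-1)%g.
have G_locally x x' y : U x y -> U x' y -> \forall z \near y, G x x' z = G x x' y.
  move=> Uy Uy'.
  have [[[oU _ _] _] [[oU' _ _] _]] := (UP x, UP x').
  have nUU : nbhs y (U x `&` U x').
    by apply: open_nbhs_nbhs; split; first exact: openI.
  have [W [oW Wp _] [Wy WU]] := dS _ _ nUU.
  have : nbhs y W by exact: open_nbhs_nbhs.
  apply: filterS => z Wz; have [v [cv Wv v0 v1]] := Wp _ _ Wy Wz.
  rewrite /G (@a_step x y z v) //; last by move=> s; have [] := WU _ (Wv s).
  rewrite (@a_step x' y z v) //; last by move=> s; have [] := WU _ (Wv s).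
  by rewrite invgM mulgA mulgK.
have [s sK] : exists s : seq S, forall y, exists2 x, x \in s & K x y.
  have [x _|s sK] := compact_finite_cover (f := K) kS; first by have [] := KP x.
  by exists s => y; exact: sK.
pose A := \bigcup_(xx in [set` s] `*` [set` s]) (G xx.1 xx.2 @` (K xx.1 `&` K xx.2)).
have finA : finite_set A.
  apply: bigcup_finite; first exact: finite_setX.
  move=> [x x'] _ /=; apply: compact_locally_constant => [|y [Ky Ky']].
    apply: subclosed_compact kS _ => //.
    by apply: closedI; [have [] := KP x|have [] := KP x'].
  by apply: G_locally; [have [_ _] := KP x; exact|have [_ _] := KP x'; exact].
have [l lA] : exists l : seq (pi1 R x0), A = [set` l] by exact/finite_seqP.
exists l; rewrite -lA; apply/seteqP; split=> // b _.
have [H1 HM HV] := is_subgroup_generated A; set H := generated A in H1 HM HV *.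
have HG x x' y : x \in s -> x' \in s -> K x y -> K x' y -> H (G x x' y).
  move=> xs xs' Ky Ky'; apply: sub_generated; exists (x, x') => //.
  by exists y.
have [x xs Kx0] := sK x0.
(* Conjugation by [a (x, x0)] is harmless: the loop is chosen for the conjugate of [b]. *)
suff loopH (p : R -> S) : continuous p -> p 0 = x0 -> p 1 = x0 ->
    H (a (x, x0) * m p * (a (x, x0))^-1)%g.
  have [p [cp p0 p1 bp]] := loop_class_surj ((a (x, x0))^-1 * b * a (x, x0))%g.
  have := loopH p cp p0 p1; rewrite /m transport_loop // -bp.
  by rewrite !mulgA mulgV mul1g mulgK.
move=> cp p0 p1.
pose init t : R -> S := fun u => p (u * t).
have cinit t : continuous (init t).
  apply: (continuous_compf _ cp) => u.
  by apply: cvgM; [exact: cvg_id|exact: cvg_cst].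
(* Follow [p] up to time [t], then return to the centre [z] inside its disc; [P] is shown to be
   locally constant in [t]. *)
pose e t z := (a (x, x0) * m (init t) * (a (z, p t))^-1)%g.
pose P t := forall z, z \in s -> K z (p t) -> H (e t z).
suff : P 1.
  move=> /(_ x xs); rewrite /e p1 (_ : init 1 = p); first by apply.
  by apply/funext => u; rewrite /init mulr1.
apply: (@connected_locally_constant R P (@connected_real R) _ 0 1); last first.
  move=> z zs; rewrite /e p0 => Kz.
  rewrite (_ : init 0 = fun=> x0); last by apply/funext => u; rewrite /init mulr0.
  by rewrite (m_cst mH mC) mulg1; exact: HG.
move=> t.
(* As the [K z] are closed, no new [K z] is entered near time [t]; as the [U z] are open, those
   [K z] met at [t] have discs that still contain the path. *)
have nK : nbhs (p t) [set y | forall z, z \in s -> K z y -> K z (p t)].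
  apply: filter_forall_seq => z _; have [Kt|nKt] := pselect (K z (p t)).
    by apply: filterS filterT.
  have [clK _ _] := KP z.
  have : nbhs (p t) (~` K z) by apply: open_nbhs_nbhs; split=> //; exact: closed_openC.
  by apply: filterS => y nKy /nKy.
have nU : nbhs (p t) [set y | forall z, z \in s -> K z (p t) -> U z y].
  apply: filter_forall_seq => z _; have [Kt|nKt] := pselect (K z (p t)); last first.
    by apply: filterS filterT => y _ /nKt.
  have [[oU _ _] _] := UP z; have [_ _ KU] := KP z.
  have : nbhs (p t) (U z) by apply: open_nbhs_nbhs; split=> //; exact: KU.
  by apply: filterS.
have : nbhs t (p @^-1` ([set y | forall z, z \in s -> K z y -> K z (p t)] `&`
    [set y | forall z, z \in s -> K z (p t) -> U z y])).
  by apply: cp; exact: filterI.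
move=> /nbhs_ballP[d /= d0 dP]; apply/nbhs_ballP; exists d => // t' tt'.
have KK z : z \in s -> K z (p t') -> K z (p t).
  by have [h _] := dP t' tt'; exact: h.
have ee z : z \in s -> K z (p t) -> e t' z = e t z.
  move=> zs Kt.
  pose v u := p (t + clamp u * (t' - t)).
  have cv : continuous v.
    apply: (continuous_compf _ cp); apply: continuous_addf; first exact: continuous_cstf.
    by apply: continuous_mulf; [exact: continuous_clamp|exact: continuous_cstf].
  have Uv u : U z (v u).
    have [] := dP (t + clamp u * (t' - t)); last by move=> _; exact.
    move: tt'; rewrite /ball /= opprD addrA subrr add0r normrN normrM distrC => tt'.
    apply: le_lt_trans tt'; rewrite -[leRHS]mul1r; apply: ler_wpM2r => //.
    by have /I01P[u0 u1] := clamp_itv u; rewrite ger0_norm.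
  have v0 : v 0 = p t by rewrite /v clamp0 mul0r addr0.
  have v1 : v 1 = p t' by rewrite /v clamp1 mul1r addrC subrK.
  have i1 : init t 1 = v 0 by rewrite v0 /init mul1r.
  rewrite /e (@a_step z (p t) (p t') v) //; last by rewrite -v0.
  rewrite (_ : m (init t') = (m (init t) * m v)%g) ?invgM ?mulgA ?mulgK //.
  rewrite -mC //; apply: mH => //; first exact: continuous_concat.
  apply: (@path_homotopic_reparam _ _ p (fun u => u * t')
    (concat (fun u => u * t) (fun u => t + clamp u * (t' - t)))) => //.
  - by move=> u; apply: cvgM; [exact: cvg_id|exact: cvg_cst].
  - apply: continuous_concat.
    + by move=> u; apply: cvgM; [exact: cvg_id|exact: cvg_cst].
    + apply: continuous_addf; first exact: continuous_cstf.
      by apply: continuous_mulf; [exact: continuous_clamp|exact: continuous_cstf].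
    + by rewrite clamp0 mul0r addr0 mul1r.
  - by rewrite concat0 !mul0r.
  - by rewrite concat1 clamp1 !mul1r addrC subrK.
  - by move=> u _; rewrite /concat; case: ifP.
split=> [Pt z zs Kz|Pt' z zs Kz].
  by rewrite ee //; [apply: Pt => //; exact: KK|exact: KK].
(* The centre [z] may be lost at [t']; a centre [w] valid at both times replaces it at the cost of
   one generator. *)
have [w ws Kw] := sK (p t').
have Kwt : K w (p t) by exact: KK.
have -> : e t z = (e t w * G w z (p t))%g by rewrite /e /G !mulgA mulgVK.
by apply: HM; [rewrite -ee //; exact: Pt'|exact: HG].
Qed.

End FiniteGeneration.

(** * Surface subgroups *)

Section SurfaceSubgroups.
Local Open Scope group_scope.
Variables (R : realType) (V : finType) (E : rel V) (E_irr : irreflexive E).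

(** Recording where the image lies allows conditions on it to accumulate through successive finite
    coverings. *)
Definition surface_embedding (H : groupType) (P : set H) :=
  exists (S : topologicalType) (x0 : S) (f : pi1 R x0 -> H),
    [/\ closed_hyperbolic_surface R S, {morph f : x y / x * y}, injective f &
        forall p, P (f p)].

Lemma contains_surface_groupP (H : groupType) :
  contains_surface_group R H <-> surface_embedding [set: H].
Proof.
split=> [[S [x0 [f [hS f_inj]]]]|[S [x0 [f [hS fM f_inj _]]]]].
  by exists S, x0, f; split=> //; exact: gmulfM.
pose f' : {multiplicative pi1 R x0 -> H} :=
  HB.pack f (isMultiplicative.Build _ _ f fM).
by exists S, x0, f'.
Qed.

Lemma contains_derivedP (H : groupType) :
  contains_surface_group R (derived_subgroup H) <->
  surface_embedding (generated (@commutators H)).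
Proof.
split=> [/contains_surface_groupP|] [S [x0 [f [hS fM f_inj fP]]]].
  exists S, x0, (fun p => val (f p)); split=> // [x y|x y /val_inj/f_inj//|p].
    by rewrite fM.
  exact: set_valP.
apply/contains_surface_groupP.
exists S, x0, (fun p => exist _ (f p) (mem_set (fP p)) : derived_subgroup H).
split=> // [x y|x y /(congr1 val)/f_inj//].
by apply: val_inj; rewrite /= fM.
Qed.

Lemma surface_embedding_kernel (G H : groupType) (P : set G) (g : G -> H) :
  {morph g : x y / x * y} -> finite_group H -> surface_embedding P ->
  surface_embedding (P `&` [set x | g x = 1]).
Proof.
move=> gM finH [S [x0 [f [hS fM f_inj fP]]]].
have gfM : {morph (fun p => g (f p)) : x y / x * y} by move=> x y; rewrite fM gM.
have := finite_quotient_kernel gfM finH.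
move=> /(surface_group_finite_index hS)[S' [y0 [h [hS' hM h_inj hP]]]].
exists S', y0, (fun p => f (h p)); split=> // [x y|x y /f_inj/h_inj//|p].
  by rewrite hM fM.
by split; [exact: fP|exact: hP].
Qed.

(** The coordinates in [F] are killed one vertex at a time, each by a finite covering. *)
Lemma surface_embedding_finite_pos (G : V -> groupType) (F : pred V) :
  (forall v, F v -> finite_group (G v)) ->
  contains_surface_group R (graph_product E G) ->
  surface_embedding [set a : graph_product E G |
    forall v, F v -> gp_pos a v = 1].
Proof.
move=> finG /contains_surface_groupP emb.
suff [S [x0 [f [hS fM f_inj fP]]]] : surface_embedding
    [set a : graph_product E G | forall v, F v -> v \in enum V -> gp_pos a v = 1].
  by exists S, x0, f; split=> // p v Fv; apply: fP; rewrite // mem_enum.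
elim: (enum V) => [|w s [S [x0 [f [hS fM f_inj fP]]]]].
  by case: emb => S [x0 [f [hS fM f_inj _]]]; exists S, x0, f.
have [Fw|nFw] := boolP (F w); last first.
  exists S, x0, f; split=> // p v Fv; rewrite inE => /orP[/eqP vw|]; last exact: fP.
  by rewrite vw (negbTE nFw) in Fv.
have posM : {morph (fun a : graph_product E G => gp_pos a w) : x y / x * y}.
  by move=> x y; rewrite gp_posM.
have emb' : surface_embedding [set a : graph_product E G |
    forall v, F v -> v \in s -> gp_pos a v = 1] by exists S, x0, f.
have [S' [y0 [h [hS' hM h_inj hP]]]] :=
  surface_embedding_kernel posM (finG _ Fw) emb'.
exists S', y0, h; split=> // p v Fv; have [h1 h2] := hP p.
by rewrite inE => /orP[/eqP ->|]; [exact: h2|exact: h1].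
Qed.

(** [F] marks the coordinates where [f v] is merely pointed. *)
Lemma surface_embedding_shift (G G' : V -> groupType) (F : pred V)
    (f : forall v, G v -> G' v) (r : forall v, G' v -> G v) :
  (forall v, f v 1 = 1) -> (forall v, cancel (f v) (r v)) ->
  (forall v, ~~ F v -> {morph f v : x y / x * y}) ->
  surface_embedding [set a : graph_product E G | forall v, F v -> gp_pos a v = 1] ->
  surface_embedding [set a : graph_product E G' | forall v, F v -> gp_pos a v = 1].
Proof.
move=> f1 fK fM [S [x0 [psi [hS psiM psi_inj psiP]]]].
have fP v : {morph f v : x y / x * y} \/ forall p, gp_pos (psi p) v = 1.
  by have [Fv|/fM] := boolP (F v); [right=> p; exact: psiP|left].
have rf p : gp_shift (fun v x => r v (f v x)) 1 (psi p) = psi p.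
  by apply: gp_shift_id => // v x; exact: fK.
have [chi [chiM chi_inj chi_pos]] := gp_shift_embedding E_irr psiM psi_inj f1 fP rf.
by exists S, x0, chi; split=> // p v Fv; rewrite chi_pos psiP.
Qed.

Lemma surface_embedding_graph_product (G : V -> groupType) P :
  surface_embedding (P : set (graph_product E G)) ->
  contains_surface_group R (graph_product E G).
Proof.
by move=> [S [x0 [f [hS fM f_inj _]]]]; apply/contains_surface_groupP; exists S, x0, f.
Qed.

Local Notation Zg := (Algebra.to_multiplicative int).
Local Notation Zm m := (Algebra.to_multiplicative 'Z_m).

Lemma finite_group_Zg m : finite_group (Zm m).
Proof. exact: (@finite_finset 'Z_m). Qed.

Lemma int_abelian (x y : Zg) : commute x y.
Proof. exact: (@addrC int x y). Qed.

Lemma cyclic_int : cyclic_group Zg.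
Proof.
exists (1%R : int); apply/seteqP; split=> // k _ H [[H1 HM HV] /(_ 1%R erefl) HH].
elim/int_rect: k => [|n IH|n IH]; first exact: H1.
  by rewrite -addn1 PoszD; exact: (HM (Posz n) (1%R : int) IH HH).
by rewrite -addn1 PoszD opprD; exact: (HM (- Posz n)%R (- 1)%R IH (HV _ HH)).
Qed.

(** Two integers between -M and M differ by at most 2M, so they are separated modulo 2M + 2; this
    modulus also exceeds 1 when M is 0. *)
Lemma Zp_int_section (M : nat) :
  exists r : 'Z_(M.*2.+2) -> int, forall k : int, (`|k| <= M)%N -> r (k%:~R)%R = k.
Proof.
pose P (y : 'Z_(M.*2.+2)) := [set k : int | (`|k| <= M)%N /\ (k%:~R = y)%R].
exists (fun y => xget 0%R (P y)) => k kM.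
have [lM le] : P (k%:~R)%R (xget 0%R (P (k%:~R)%R)) by apply: xgetPex; exists k.
set l := xget _ _ in lM le *.
have : ((`|l - k|%N)%:R = 0 :> 'Z_(M.*2.+2))%R.
  have : ((l - k)%:~R = 0 :> 'Z_(M.*2.+2))%R by rewrite intrB le subrr.
  case: (l - k)%R => n //=; rewrite NegzE mulrNz => /eqP.
  by rewrite oppr_eq0 => /eqP.
move=> /(congr1 (@nat_of_ord _)); rewrite val_Zp_nat // modn_small => [e|]; last by lia.
by apply/eqP; rewrite -subr_eq0 -absz_eq0; apply/eqP.
Qed.

Lemma derived_raag_GPm :
  contains_surface_group R (derived_subgroup (raag E)) ->
  exists m, (2 <= m)%N /\ contains_surface_group R (GPm E m).
Proof.
move=> /contains_derivedP[S [x0 [psi [hS psiM psi_inj psiD]]]].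
have psi_pos p : gp_pos (psi p) = 1.
  by apply: (derived_gp_pos E_irr _ (psiD p)) => v; exact: int_abelian.
have [gens gensP] := surface_group_fg x0 hS.
(* [M] bounds the coordinates of all vertices visited by the paths of the generators. *)
have [M MP] : exists M : nat, forall e : V -> Zg -> Zg,
    (forall v (k : int), (`|k| <= M)%N -> e v k = k) ->
    forall p, p \in gens -> gp_shift e 1 (psi p) = psi p.
  elim: {gensP} gens => [|p s [M MP]]; first by exists 0%N.
  have [l lP] := gp_shift_fix E_irr 1 (psi p).
  exists (maxn M (\max_(t <- l) \max_(v : V) `|t v : int|%N)) => e eP q.
  rewrite inE => /orP[/eqP ->|]; last first.
    by apply: MP => v k kM; apply: eP; rewrite leq_max kM.
  apply: lP => t tl v; apply: eP; rewrite leq_max; apply/orP; right.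
  apply: leq_trans (leq_bigmax_seq _ tl isT) => /=.
  by rewrite (leq_bigmax v).
have [r rP] := Zp_int_section M.
exists M.*2.+2; split=> //.
pose f (v : V) (k : Zg) : Zm M.*2.+2 := ((k : int)%:~R)%R.
have fM v : {morph f v : x y / x * y} by move=> x y; exact: intrD.
pose e (v : V) (x : Zg) : Zg := r (f v x).
have rf p : gp_shift e 1 (psi p) = psi p.
  have : generated [set` gens] p by rewrite gensP.
  apply: (@generated_min _ _ [set p | gp_shift e 1 (psi p) = psi p]);
    last first.
    by move=> q /=; apply: MP => v k kM; exact: rP.
  (* The section [r] is not a morphism, but elements of the derived subgroup have closed paths, so
     reading from [1] is multiplicative on them. *)
  have sM : {morph (fun p => gp_shift e 1 (psi p)) : x y / x * y}.
    by move=> x y; rewrite psiM gp_shiftM // psi_pos mulg1.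
  split=> [|x y /= ex ey|x /= ex].
  - by rewrite /= (morph_group1 psiM) gp_shift1.
  - by rewrite (sM x y) ex ey psiM.
  - by rewrite (morph_groupV sM) ex (morph_groupV psiM).
have [chi [chiM chi_inj _]] := gp_shift_embedding E_irr (f := f) (r := fun=> r)
  psiM psi_inj
  (fun v => morph_group1 (fM v)) (fun v => or_introl (fM v)) rf.
by apply/contains_surface_groupP; exists S, x0, chi.
Qed.

Lemma racg_graph_product (G : V -> groupType) :
  (forall v, nontrivial_group (G v)) -> contains_surface_group R (racg E) ->
  contains_surface_group R (graph_product E G).
Proof.
move=> nG /(@surface_embedding_finite_pos _ predT) emb.
pose g v := sval (cid (nG v)).
have g1 v : g v <> 1 by exact: svalP (cid (nG v)).
apply: surface_embedding_graph_product.
pose f v (k : Zm 2) : G v := if k == 1 then 1 else g v.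
(* The identity of [Zm 2] is the residue 0; [1%R] is its other element. *)
pose r v (x : G v) : Zm 2 := if x == 1 then 1 else (1 : 'Z_2)%R.
apply: (@surface_embedding_shift _ _ predT f r) => [v|v k|//|].
- by rewrite /f eqxx.
- rewrite /r /f; have [->|k1] := eqVneq k 1; first by rewrite eqxx.
  case: eqP => [/g1//|_]; apply/val_inj.
  by case: k k1 => [[|[|k]] hk].
- by apply: emb => v _; exact: finite_group_Zg.
Qed.

Lemma cyclic_raag (G : V -> groupType) : (forall v, cyclic_group (G v)) ->
  contains_surface_group R (graph_product E G) ->
  contains_surface_group R (raag E).
Proof.
move=> cG emb; apply: surface_embedding_graph_product.
(* Finite vertex groups map to the integers only as pointed sets, so their coordinates are killed;
   infinite ones map by a morphism. *)
pose F v := `[< finite_group (G v) >].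
have : forall v, exists fr : (G v -> Zg) * (Zg -> G v),
    [/\ fr.1 1 = 1, cancel fr.1 fr.2 & ~~ F v -> {morph fr.1 : x y / x * y}].
  move=> v; have [|[f [r [fM fK]]]] := cyclic_group_int (cG v).
    move=> /[dup] fin /finite_group_int[f [r [f1 fK]]]; exists (f, r); split=> //.
    by move=> /asboolP.
  by exists (f, r); split=> //; exact: morph_group1.
move=> /(_ _)/cid fr.
apply: (@surface_embedding_shift _ _ F (fun v => (sval (fr v)).1)
  (fun v => (sval (fr v)).2)) => [v|v|v|].
- by have [] := svalP (fr v).
- by have [] := svalP (fr v).
- by have [] := svalP (fr v).
- by apply: surface_embedding_finite_pos emb => v /asboolP.
Qed.

Lemma finite_derived_raag (G : V -> groupType) : (forall v, finite_group (G v)) ->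
  contains_surface_group R (graph_product E G) ->
  contains_surface_group R (derived_subgroup (raag E)).
Proof.
move=> fG /(@surface_embedding_finite_pos _ predT (fun v _ => fG v)) emb.
have fr v := cid (finite_group_int (fG v)).
have fr' v := cid (svalP (fr v)).
have [S [x0 [psi [hS psiM psi_inj psiP]]]] : surface_embedding
    [set a : graph_product E (fun=> Zg) | forall v, predT v -> gp_pos a v = 1].
  apply: (@surface_embedding_shift G _ predT (fun v => sval (fr v))
    (fun v => sval (fr' v)) _ _ _ emb) => [v|v|//].
  - by have [] := svalP (fr' v).
  - by have [] := svalP (fr' v).
apply/contains_derivedP; exists S, x0, psi; split=> // p.
apply: (gp_pos_derived E_irr).
by apply: functional_extensionality_dep => v; exact: psiP.
Qed.

Lemma finite_GPm (G : V -> groupType) : (forall v, finite_group (G v)) ->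
  contains_surface_group R (graph_product E G) ->
  exists m, (2 <= m)%N /\ contains_surface_group R (GPm E m).
Proof.
move=> fG /(@surface_embedding_finite_pos _ predT (fun v _ => fG v)) emb.
have nP v := cid (finite_group_Zp (fG v)).
pose m := maxn 2 (\max_(v : V) sval (nP v)).
have m2 : (1 < m)%N by rewrite leq_max.
have nm v : (sval (nP v) <= m)%N.
  by rewrite leq_max (leq_bigmax v) orbT.
have fr v := cid (svalP (nP v) m m2 (nm v)).
have fr' v := cid (svalP (fr v)).
exists m; split=> //; apply: surface_embedding_graph_product.
apply: (@surface_embedding_shift G _ predT (fun v => sval (fr v))
  (fun v => sval (fr' v)) _ _ _ emb) => [v|v|//].
- by have [] := svalP (fr' v).
- by have [] := svalP (fr' v).
Qed.

End SurfaceSubgroups.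

Theorem theorem4 (R : realType) (V : finType) (E : rel V)
    (E_sym : symmetric E) (E_irr : irreflexive E) :
  (contains_surface_group R (racg E) <->
   forall G : V -> groupType, (forall v, nontrivial_group (G v)) ->
     contains_surface_group R (graph_product E G)) /\
  (contains_surface_group R (raag E) <->
   exists G : V -> groupType, (forall v, cyclic_group (G v)) /\
     contains_surface_group R (graph_product E G)) /\
  ((contains_surface_group R (derived_subgroup (raag E)) <->
    exists G : V -> groupType, (forall v, finite_group (G v)) /\
      contains_surface_group R (graph_product E G)) /\
   ((exists G : V -> groupType, (forall v, finite_group (G v)) /\
      contains_surface_group R (graph_product E G)) <->
    exists m : nat, (2 <= m)%N /\ contains_surface_group R (GPm E m))).
Proof.
have GPm_finite m : contains_surface_group R (GPm E m) ->
    exists G : V -> groupType, (forall v, finite_group (G v)) /\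
      contains_surface_group R (graph_product E G).
  by move=> h; exists (fun=> Algebra.to_multiplicative 'Z_m); split=> // v;
    exact: finite_group_Zg.
split; last split; last split.
- split=> [h G nG|]; first exact: racg_graph_product.
  by apply=> v; exists (1 : 'Z_2)%R.
- split=> [h|[G [cG h]]]; last exact: cyclic_raag cG h.
  exists (fun=> Algebra.to_multiplicative int); split=> // v.
  exact: cyclic_int.
(* From (a) to (b) the proof passes through (c), whose vertex groups are finite. *)
- split=> [/(derived_raag_GPm E_irr)[m [_ /GPm_finite//]]|[G [fG h]]].
  exact: finite_derived_raag fG h.
- split=> [[G [fG h]]|[m [_ /GPm_finite//]]].
  exact: finite_GPm fG h.
Qed.
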